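(* Let $k\ge 1$ be an integer. Let $M\colon\mathbb{R}\to\mathbb{C}$ be any function, with real part $M_1:=\operatorname{Re}M$ and imaginary part $M_2:=\operatorname{Im}M$, satisfying all of the following conditions: (a) for every distribution function $F$ on $\mathbb{R}$, every real $T>0$, and every real $x$, $$\tfrac12F(\infty-)+\mathfrak{G}\big(t\mapsto M(-t/T)f_F(t)\big)(x)\le F(x-)\le F(x+)\le \tfrac12F(\infty-)+\mathfrak{G}\big(t\mapsto M(t/T)f_F(t)\big)(x),$$ where $f_F(t):=\int_{\mathbb{R}}e^{itx}\,dF(x)$; (b) $M(t)=0$ whenever $|t|>1$; (c) $M_1$ is even and $M_2$ is odd; (d) for some real constant $\varkappa$, the function $t\mapsto (M(t)-\varkappa)/t$ is in $L^1([-1,1])$. Then for all real $T>0$, all real $x\ge0$, and all real-valued random variables $X$ with $\mathsf{E}|X|^k<\infty$, $$\Big|x^k\,\mathsf{P}(X\ge x)-\mathfrak{G}\big(M_{1,T}\,\mathsf{E}X^k(W_X-V_X)\big)(x)\Big|\le i\,\mathfrak{G}\big(M_{2,T}\,\mathsf{E}|X|^k(W_X+V_X)\big)(x).$$ This inequality also holds with $\mathsf{P}(X>x)$ in place of $\mathsf{P}(X\ge x)$.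
   Context: For a function $f\colon\mathbb{R}\to\mathbb{C}$ and real $x$, $$\mathfrak{G}(f)(x):=\frac{i}{2\pi}\,\mathrm{p.v.}\!\int_{-\infty}^{\infty}e^{-itx}f(t)\,\frac{dt}{t},$$ where $\mathrm{p.v.}\int_{-\infty}^{\infty}:=\lim_{\varepsilon\downarrow0,\,A\uparrow\infty}\big(\int_{-A}^{-\varepsilon}+\int_{\varepsilon}^{A}\big)$. $F(x-)$ and $F(x+)$ denote the left and right limits of $F$ at $x$, and $F(\infty-):=\lim_{x\to\infty}F(x)$ (which is $1$ for a distribution function). For $j\in\{1,2\}$ and $T>0$, $M_{j,T}(t):=M_j(t/T)$ for real $t$. For real $t$, $V_X(t):=e^{itX}$ and $W_X(t):=\int_0^1 e^{i\alpha tX}\,k\alpha^{k-1}\,d\alpha$. Thus $\mathsf{E}X^k(W_X-V_X)$ denotes the function $t\mapsto\mathsf{E}\big[X^k(W_X(t)-V_X(t))\big]$, and $\mathsf{E}|X|^k(W_X+V_X)$ denotes the function $t\mapsto\mathsf{E}\big[|X|^k(W_X(t)+V_X(t))\big]$; $M_{1,T}\,\mathsf{E}X^k(W_X-V_X)$ and $M_{2,T}\,\mathsf{E}|X|^k(W_X+V_X)$ are pointwise products of functions of $t$. *)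

(* Defs.v *)
From mathcomp Require Import all_boot all_order all_algebra.
From mathcomp Require Import all_classical all_reals all_analysis.
From mathcomp Require Import complex.

Set Implicit Arguments.
Unset Strict Implicit.
Unset Printing Implicit Defensive.

Import Order.TTheory GRing.Theory Num.Theory.
Import numFieldNormedType.Exports.

Local Open Scope classical_set_scope.
Local Open Scope complex_scope.
Local Open Scope ring_scope.

(* The order on [R[i]] is MathComp's: [z <= w] means [Im z = Im w] and
   [Re z <= Re w], so an inequality between complex numbers asserts in
   particular that they differ by a real number, and [`|z| <= w] that [w] is
   real; [`|z|] is the modulus, as a complex number. *)

Definition expi {R : realType} (theta : R) : R[i] := cos theta +i* sin theta.

Section complex_valued_integrals.
Context {d : measure_display} {T : measurableType d} {R : realType}.

Definition cintegrable (mu : {measure set T -> \bar R}) (D : set T)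
    (f : T -> R[i]) : Prop :=
  mu.-integrable D (fun t => (complex.Re (f t))%:E) /\
  mu.-integrable D (fun t => (complex.Im (f t))%:E).

Definition cintegral (mu : {measure set T -> \bar R}) (D : set T)
    (f : T -> R[i]) : R[i] :=
  Rintegral mu D (fun t => complex.Re (f t))
  +i* Rintegral mu D (fun t => complex.Im (f t)).

Definition cexpectation (P : probability T R) (Z : T -> R[i]) : R[i] :=
  fine 'E_P[fun w => complex.Re (Z w)] +i* fine 'E_P[fun w => complex.Im (Z w)].

End complex_valued_integrals.

Section principal_value.
Context {R : realType}.
Implicit Types (f : R -> R[i]) (x : R).

(* [lebesgue_measure] only knows Borel sets; its completion is used here so
   that Lebesgue measurable functions [f] that are not Borel are covered. *)
Definition pv_truncated f (p : R * R) : R[i] :=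
  cintegral completed_lebesgue_measure `[- p.2, - p.1] f
  + cintegral completed_lebesgue_measure `[p.1, p.2] f.

(* joint limit: the first component decreases to 0, the second tends to +oo *)
Definition pv_filter : set_system (R * R) :=
  filter_prod (0 : R)^'+ (pinfty_nbhs R).

Definition pv_exists f : Prop :=
  [/\ forall e A : R, 0 < e -> e < A ->
        cintegrable completed_lebesgue_measure `[- A, - e] f /\
        cintegrable completed_lebesgue_measure `[e, A] f,
      cvg ((fun p => complex.Re (pv_truncated f p)) @ pv_filter)
    & cvg ((fun p => complex.Im (pv_truncated f p)) @ pv_filter)].

Definition pv f : R[i] :=
  lim ((fun p => complex.Re (pv_truncated f p)) @ pv_filter)
  +i* lim ((fun p => complex.Im (pv_truncated f p)) @ pv_filter).

Definition Gkernel f x (t : R) : R[i] := expi (- (t * x)) * f t / t%:C.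

Definition Gexists f x : Prop := pv_exists (Gkernel f x).

(* ['i%C] is [0 +i* 1]; the generic [Num.imaginary] is only some square root
   of -1.  Meaningful only under [Gexists f x]: [lim], [integral] and [fine] are total
   functions with junk values. *)
Definition G f x : R[i] := 'i%C / (2 * pi)%:C * pv (Gkernel f x).

End principal_value.

Section distribution_functions.
Context {R : realType}.

(* A distribution function is a right-continuous nondecreasing function with
   limits 0 at -oo and 1 at +oo. *)
Definition charf (F : cumulativeBounded (0 : R) (1 : R)) (t : R) : R[i] :=
  cintegral (lebesgue_stieltjes_measure F) setT (fun y : R => expi (t * y)).

Definition flim_left (F : R -> R) (x : R) : R := lim (F y @[y --> x^'-]).
Definition flim_right (F : R -> R) (x : R) : R := lim (F y @[y --> x^'+]).
Definition flim_infty (F : R -> R) : R := lim (F y @[y --> +oo]).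

End distribution_functions.

Section smoothing_filter.
Context {R : realType}.
Variable M : R -> R[i].

Definition M1 (t : R) : R := complex.Re (M t).
Definition M2 (t : R) : R := complex.Im (M t).

Definition smoothing_inequalities : Prop :=
  forall (F : cumulativeBounded (0 : R) (1 : R)) (T x : R), 0 < T ->
  [/\ Gexists (fun t => M (- t / T) * charf F t) x
        /\ Gexists (fun t => M (t / T) * charf F t) x,
      (2^-1 * flim_infty F)%:C + G (fun t => M (- t / T) * charf F t) x
        <= (flim_left F x)%:C,
      flim_left F x <= flim_right F x
    & (flim_right F x)%:C
        <= (2^-1 * flim_infty F)%:C + G (fun t => M (t / T) * charf F t) x].

End smoothing_filter.

Section V_and_W.
Context {R : realType}.

Definition V (X t : R) : R[i] := expi (t * X).

Definition W (k : nat) (X t : R) : R[i] :=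
  cintegral lebesgue_measure `[0, 1]
    (fun a : R => expi (a * t * X) * (k%:R * a ^+ k.-1)%:C).

End V_and_W.

(* Main.v *)
From HB Require Import structures.
Require Import Defs.
From mathcomp Require Import all_boot all_order all_algebra.
From mathcomp Require Import all_classical all_reals all_analysis.
From mathcomp Require Import measurable_realfun.
From mathcomp Require Import complex.
From mathcomp Require Import ring lra.

Set Implicit Arguments.
Unset Strict Implicit.
Unset Printing Implicit Defensive.

Import Order.TTheory GRing.Theory Num.Theory.
Import numFieldNormedType.Exports.

Local Open Scope classical_set_scope.
Local Open Scope complex_scope.
Local Open Scope ring_scope.

(** Write [M = M1 + i M2] and, for [0 < T], [q1 t = M1 (t / T) / t] (odd) and
    [q2 t = M2 (t / T) / t] (even).  By parity, the principal values that
    define [G] reduce to limits, as [e] decreases to [0], of the truncated sine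
    and cosine transforms
      [a_e u = int_e^T q1 t * sin (t u) dt],  [b_e u = int_e^T q2 t * cos (t u) dt].

    The smoothing hypothesis is used for a single distribution, the unit mass
    at [0], whose characteristic function is [1].  It says ([dirac_smoothing])
    that [a_e u] and [b_e u] have limits [a u] and [b u], and that
      [1/2 + (a u + b u) / pi <= 1{0 < u} <= 1{0 <= u} <= 1/2 + (a u - b u) / pi],
    that is: both indicators minus [1/2] are within [- b u / pi] of [a u / pi].

    For a deterministic value [y] of [X], [V] is the characteristic function of
    the unit mass at [y], and [W] that of [A y], where [A] has the density
    [k A^(k-1)] on [[0, 1]].  Replacing [a u / pi] by an indicator minus [1/2] in
      [y^k * (E (a (x - A y)) - a (x - y)) / pi]
    therefore costs at most [- |y|^k * (E (b (x - A y)) + b (x - y)) / pi], and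
    what is left is, for [0 <= x],
      [y^k * (P (A y <= x) - 1{y < x}) = x^k * 1{x <= y}],
    because [P (A y <= x)] is [1] for [y < x] and [(x / y)^k] for [x <= y]; with
    [1{y <= x}] on the left one gets [1{x < y}] on the right
    ([power_indicator], [pointwise_smoothing]).  The theorem is the expectation
    of this inequality.

    What remains is to exchange [E] and the average over [A] with the principal
    value.  For a fixed [e] this is Fubini; the limit in [e] is dominated
    convergence ([kernel_average_cvg]), which requires a bound on [a_e u] and
    [b_e u] uniform in [e] and [u] ([cut_bounded]).  Integrability of
    [(M t - kappa) / t] gives it up to [kappa] times the sine integral, and the
    latter is bounded because [dirac_smoothing] bounds [a u]. *)

(** The line with the sigma-algebra on which [completed_lebesgue_measure] is
    defined; [R] itself carries the Borel sets. *)
Local Notation completed_line R := (caratheodory_type ((wlength (idfun : R -> R))^*)%mu).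

(** * The completed Lebesgue measure *)

Section completed_lebesgue.
Context {R : realType}.
Notation lam := (@completed_lebesgue_measure R).
Notation cR := (completed_line R).

Lemma borel_completed_measurable (A : set R) :
  measurable A -> measurable (A : set cR).
Proof. exact: sub_caratheodory. Qed.

Lemma borel_preimage_scale (c : R) (A : set R) :
  measurable A -> measurable [set t : R | A (c * t)].
Proof.
move=> mA; rewrite -[X in measurable X]setTI.
exact: (@mulrl_measurable R setT c measurableT A mA).
Qed.

Lemma completed_lebesgue_measure_itv (i : interval R) :
  lam [set` i] = (if (i.1 < i.2)%E then (i.2 : \bar R) - i.1 else 0)%E.
Proof. exact: lebesgue_measure_itv. Qed.

(** Both sides are measures in [A] and agree on half-open intervals. *)
Lemma lebesgue_measure_scale (c : R) (A : set R) : c != 0 -> measurable A ->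
  lebesgue_measure [set t : R | A (c * t)] = (`|c|^-1%:E * lebesgue_measure A)%E.
Proof.
move=> c0 mA.
have mc : measurable_fun setT (fun t : measurableTypeR R => c * t : measurableTypeR R).
  exact: mulrl_measurable.
pose m0 : {measure set (measurableTypeR R) -> \bar R} :=
  measure_function_pushforward__canonical__measure_function_Measure lebesgue_measure mc.
pose m : {measure set (measurableTypeR R) -> \bar R} :=
  mscale (NngNum (normr_ge0 c)) m0.
rewrite (@lebesgue_measure_unique R m _ A mA) => [|_ [[a b] _ <-]]; last first.
  have -> : m `]a, b]%classic =
      (`|c|%:E * lebesgue_measure ([set t | `]a, b]%classic (c * t)%R] : set R))%E.
    by [].
  have [c_gt0|c_lt0] := ltP 0 c.
    rewrite (_ : [set t | `]a, b]%classic (c * t)] = `]a / c, b / c]%classic) ?lebesgue_measure_itv/=.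
      rewrite !lte_fin ltr_pM2r ?invr_gt0//; case: (a < b); last by rewrite mule0.
      by rewrite -!EFinB -EFinM gtr0_norm// -mulrBl mulrC divfK.
    apply/seteqP; split=> t /=; rewrite !in_itv/=;
      by rewrite ltr_pdivrMr// ler_pdivlMr// mulrC.
  have {}c_lt0 : c < 0 by rewrite lt_neqAle c0.
  rewrite (_ : [set t | `]a, b]%classic (c * t)] = `[b / c, a / c[%classic) ?lebesgue_measure_itv/=.
    rewrite !lte_fin ltr_nM2r ?invr_lt0//; case: (a < b); last by rewrite mule0.
    by rewrite -!EFinB -EFinM ltr0_norm// -mulrBl mulrC mulrN divfK// opprB.
  apply/seteqP; split=> t /=; rewrite !in_itv/=;
    by rewrite ltr_ndivlMr// ler_ndivrMr// mulrC andbC.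
rewrite /m /mscale/= /pushforward muleA -EFinM mulVf ?normr_eq0// mul1e.
by congr (lebesgue_measure _).
Qed.

(** A completed measurable set is a Borel set up to a negligible one, and a
    dilation preserves both kinds of sets. *)
Lemma completed_measurable_scale (c : R) : c != 0 ->
  measurable_fun setT (fun t : cR => c * t : cR).
Proof.
move=> c0 _ A; rewrite setTI -!completed_caratheodory_measurable.
rewrite !g_sigma_completed_algebra_genE => -[B mB [N [C [mC C0 NC]] <-]].
exists [set t : R | B (c * t)]; first exact: borel_preimage_scale.
exists [set t : R | N (c * t)]; last by [].
exists [set t : R | C (c * t)]; split.
- exact: borel_preimage_scale.
- by rewrite lebesgue_measure_scale// C0 mule0.
- by move=> t /NC.
Qed.

Lemma completed_measure_scale (c : R) (A : set cR) : c != 0 -> measurable A ->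
  lam [set t : R | A (c * t)] = (`|c|^-1%:E * lam A)%E.
Proof.
move=> c0; rewrite -completed_caratheodory_measurable.
rewrite g_sigma_completed_algebra_genE => -[B mB [N [C [mC C0 NC]] <-]].
(* adding a negligible set does not change the measure of a Borel set *)
have sw (D E : set R) : measurable D -> measurable E -> lebesgue_measure E = 0%E ->
    forall M : set R, M `<=` E -> lam (D `|` M) = lebesgue_measure D.
  move=> mD mE E0 M ME; apply/eqP; rewrite eq_le; apply/andP; split.
    apply: (@le_trans _ _ (lebesgue_measure (D `|` E))).
      by apply: (le_outer_measure ((wlength idfun)^*)%mu); exact: setUS.
    have : (lebesgue_measure (D `|` E) <= lebesgue_measure D + lebesgue_measure E)%E.
      exact: measureU2.
    by rewrite E0 adde0.
  by apply: (le_outer_measure ((wlength idfun)^*)%mu); exact: subsetUl.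
rewrite (sw B C)// -lebesgue_measure_scale//.
apply: (sw _ [set t : R | C (c * t)]) => //.
- exact: borel_preimage_scale.
- exact: borel_preimage_scale.
- by rewrite lebesgue_measure_scale// C0 mule0.
- by move=> t /NC.
Qed.

Lemma ge0_completed_integral_scale (c : R) (D : set cR) (f : cR -> \bar R) :
  c != 0 -> measurable D -> measurable_fun D f -> (forall t, 0 <= f t)%E ->
  (\int[lam]_(t in [set t : R | D (c * t)%R]) f (c * t)%R =
   `|c|^-1%:E * \int[lam]_(t in D) f t)%E.
Proof.
move=> c0 mD mf f0; have mc := completed_measurable_scale c0.
rewrite -(ge0_integral_pushforward mc lam mD mf) => [|t _]; last exact: f0.
have c1 : 0 <= `|c|^-1 by rewrite invr_ge0.
rewrite -(@ge0_integral_mscale _ _ _ lam D mD (NngNum c1))//.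
by apply: eq_measure_integral => A mA _; exact: completed_measure_scale.
Qed.

(** For [c = -1] this is the reflection that folds a symmetric principal value,
    and for [c > 0] the change of variable that relates different [T]. *)
Lemma completed_integral_scale (c : R) (D : set cR) (f : R -> R) : c != 0 ->
  measurable D -> lam.-integrable D (fun t => (f t)%:E) ->
  lam.-integrable [set t : R | D (c * t)] (fun t => (f (c * t))%:E) /\
  \int[lam]_(t in [set t | D (c * t)]) f (c * t) = `|c|^-1 * \int[lam]_(t in D) f t.
Proof.
move=> c0 mD /[dup] fi /integrableP[mf ioo].
have mc := completed_measurable_scale c0.
have mfc : measurable_fun [set t : cR | D (c * t)] (fun t => (f (c * t))%:E).
  apply: (@measurable_comp _ _ _ _ _ _ D (EFin \o f)) => //.
  - by move=> t /= [u Du <-].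
  - by apply: measurable_funTS.
have scale (g : cR -> \bar R) := @ge0_completed_integral_scale c D g c0 mD.
split.
  apply/integrableP; split => //.
  have en := scale (fun t => `|(f t)%:E|%E) (measurableT_comp (@abse_measurable R setT) mf)
    (fun t => abse_ge0 _).
  by rewrite en lte_mul_pinfty// lee_fin invr_ge0.
rewrite /Rintegral -[X in X * _]/(fine (`|c|^-1%:E)) -fineM//; last first.
  exact: integrable_fin_num.
congr fine; rewrite integralE [in RHS]integralE.
have e1 := scale (fun t => (EFin \o f)^\+ t)%E (measurable_funepos mf)
  (fun t => funepos_ge0 _ t).
have e2 := scale (fun t => (EFin \o f)^\- t)%E (measurable_funeneg mf)
  (fun t => funeneg_ge0 _ t).
rewrite muleBr; [|by []|].
  rewrite -e1 -e2; congr (_ - _)%E; apply: eq_integral => t _.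
    by rewrite !funeposE.
  by rewrite !funenegE.
by apply: fin_num_adde_defr; exact: integrable_pos_fin_num fi.
Qed.

Lemma completed_measurable_itv (i : interval R) : measurable ([set` i] : set cR).
Proof. by apply: borel_completed_measurable; exact: measurable_itv. Qed.

Lemma completed_measurable_fun (D : set cR) (f : R -> R) :
  measurable D -> measurable_fun setT f -> measurable_fun D (f : cR -> R).
Proof.
move=> mD mf _ A mA; apply: measurableI => //.
by apply: borel_completed_measurable; rewrite -[X in measurable X]setTI; exact: mf.
Qed.

Lemma measurable_completed_id : measurable_fun setT (fun t : cR => t : R).
Proof. exact: completed_measurable_fun. Qed.

Lemma integrable_mul_bounded (D : set cR) (q c : R -> R) (B : R) :
  measurable D -> lam.-integrable D (EFin \o q) ->
  measurable_fun setT c -> (forall t, `|c t| <= B) ->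
  lam.-integrable D (fun t => (q t * c t)%:E).
Proof.
move=> mD iq mc cB.
have B0 : 0 <= B by exact: le_trans (cB 0).
apply: (@le_integrable _ _ _ _ _ mD _ (fun t => B%:E * (q t)%:E)%E).
- apply/measurable_EFinP; apply: measurable_funM.
    by move/integrableP : iq => [/measurable_EFinP].
  exact: completed_measurable_fun.
- by move=> t _; rewrite lee_fin /= !normrM mulrC (ger0_norm B0) ler_wpM2r.
- exact: integrableZl.
Qed.

Lemma le_norm_integral_bounded (D E : set cR) (q c : R -> R) :
  measurable D -> measurable E -> D `<=` E -> lam.-integrable E (EFin \o q) ->
  measurable_fun setT c -> (forall t, `|c t| <= 1) ->
  `|\int[lam]_(t in D) (q t * c t)| <= \int[lam]_(t in E) `|q t|.
Proof.
move=> mD mE DE iq mc c1.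
have iqD : lam.-integrable D (EFin \o q) by exact: integrableS iq.
have iqc := integrable_mul_bounded mD iqD mc c1.
apply: (le_trans (le_normr_Rintegral mD iqc)).
have iqcn := integrable_norm iqc.
have iqn := integrable_norm iq.
apply: (@le_trans _ _ (\int[lam]_(t in D) `|q t|)).
  apply: le_Rintegral => //; first exact: integrable_norm.
  by move=> t _; rewrite normrM ler_piMr.
apply: fine_le; [|exact: integrable_fin_num|].
  by apply: integrable_fin_num => //; exact: integrable_norm.
apply: (ge0_subset_integral _ mD mE) DE => [|t _]; last by rewrite lee_fin.
exact: measurable_int iqn.
Qed.

Lemma integrable_bounded_itv (f : R -> R) (B : R) (i : interval R) (a b : R) :
  measurable_fun setT f -> (forall t, `|f t| <= B) ->
  [set` i] `<=` `[a, b]%classic -> lam.-integrable [set` i] (EFin \o f).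
Proof.
move=> mf fB iab; have mi := completed_measurable_itv i.
apply: (@measurable_bounded_integrable _ cR) => //.
- apply: (@le_lt_trans _ _ (lam `[a, b])).
    by apply: le_measure => //; rewrite inE//; exact: completed_measurable_itv.
  by rewrite completed_lebesgue_measure_itv/=; case: ifP; rewrite ltry.
- exact: completed_measurable_fun.
- exists B; split; first exact: num_real.
  by move=> M vM t _; apply: (le_trans (fB t)); exact: ltW.
Qed.

Lemma Rintegral_setU_itv (f : R -> R) (i j l : interval R) :
  [set` l] = [set` i] `|` [set` j] -> [set` i] `&` [set` j] = set0 ->
  lam.-integrable [set` l] (EFin \o f) ->
  \int[lam]_(t in [set` l]) f t =
    \int[lam]_(t in [set` i]) f t + \int[lam]_(t in [set` j]) f t.
Proof.
move=> E dis; rewrite E => fi; apply: Rintegral_setU => //.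
- exact: completed_measurable_itv.
- exact: completed_measurable_itv.
- by apply/disj_setPS; rewrite dis.
Qed.

End completed_lebesgue.
Arguments measurable_completed_id R : clear implicits.

(** * Averaging truncated integral transforms *)

Section averaging.
(** The kernel [phi (t, .)] is averaged over [S].  The weight [q] is integrated
    over [D] only: near the singularity of a principal value it need not be
    integrable. *)
Context d1 d2 (T1 : measurableType d1) (S : measurableType d2) (R : realType).
Context (l : {sigma_finite_measure set T1 -> \bar R}).
Context (m : {sigma_finite_measure set S -> \bar R}).
Variables (q : T1 -> R) (phi : T1 * S -> R) (w : S -> R).
Hypothesis mphi : measurable_fun setT phi.
Hypothesis phiw : forall t s, `|phi (t, s)| <= w s.
Hypothesis iw : m.-integrable setT (EFin \o w).

Let w0 s : `|w s| = w s.
Proof. by rewrite ger0_norm// (le_trans _ (phiw point s)). Qed.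

Let mphi1 t : measurable_fun setT (fun s => phi (t, s)).
Proof. exact: measurableT_comp mphi (measurable_pair1 _). Qed.

Let mphi2 s : measurable_fun setT (fun t => phi (t, s)).
Proof. exact: measurableT_comp mphi (measurable_pair2 _). Qed.

Lemma integrable_dominated_section t :
  m.-integrable setT (fun s => (phi (t, s))%:E).
Proof.
apply: le_integrable iw => //; first exact/measurable_EFinP.
by move=> s _; rewrite lee_fin /= w0.
Qed.

Section fixed_domain.
Variable D : set T1.
Hypothesis mD : measurable D.
Hypothesis iq : l.-integrable D (EFin \o q).

Let iqD : l.-integrable setT (EFin \o (q \_ D)).
Proof. by rewrite -restrict_EFin; exact/(integrable_mkcond _ mD).1. Qed.

Let mqphi : measurable_fun setT (fun z : T1 * S => ((q \_ D) z.1 * phi z)%:E).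
Proof.
apply/measurable_EFinP; apply: measurable_funM => //.
apply: measurableT_comp => //.
by move/integrableP: iqD => [/measurable_EFinP].
Qed.

Lemma integrable_kernel_prod :
  (l \x m)%E.-integrable setT (fun z => ((q \_ D) z.1 * phi z)%:E).
Proof.
apply/integrable12ltyP => //=.
apply: (@le_lt_trans _ _ (\int[l]_t (`|(q \_ D) t| * \int[m]_s w s)%:E)%E).
  apply: ge0_le_integral => //.
  - by move=> t _; exact: integral_ge0.
  - apply: (measurable_fun_fubini_tonelli_F (fun z => `|((q \_ D) z.1 * phi z)%:E|%E)) => //.
    exact: measurableT_comp.
  - apply/measurable_EFinP; apply: measurable_funM => //.
    apply: measurableT_comp => //.
    by move/integrableP: iqD => [/measurable_EFinP].
  move=> t _.
  rewrite EFinM /Rintegral fineK; last exact: integrable_fin_num.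
  rewrite -integralZl//; apply: ge0_le_integral => //.
  - apply/measurable_EFinP; apply: measurableT_comp => //.
    exact: measurable_funM.
  - by apply: measurable_int (integrableZl _ _ iw).
  - by move=> s _; rewrite lee_fin normrM ler_wpM2l.
have : l.-integrable setT (fun t => (`|(q \_ D) t| * \int[m]_s w s)%:E).
  under eq_fun do rewrite mulrC EFinM.
  by apply: integrableZl => //; exact: integrable_norm.
exact: integrable_lty.
Qed.

Let section_integral t :
  (\int[m]_s ((q \_ D) t * phi (t, s))%:E =
   ((fun t => q t * \int[m]_s phi (t, s)) \_ D t)%:E)%E.
Proof.
rewrite !patchE; case: ifPn => tD; last first.
  by apply: integral0_eq => s _; rewrite mul0r.
under eq_integral do rewrite EFinM.
rewrite integralZl//; last exact: integrable_dominated_section.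
by rewrite EFinM /Rintegral fineK// integrable_fin_num// integrable_dominated_section.
Qed.

Lemma integrable_kernel_section s :
  l.-integrable D (fun t => (q t * phi (t, s))%:E).
Proof.
apply: (@le_integrable _ _ _ _ _ mD _ (fun t => (w s)%:E * (q t)%:E)%E).
- apply/measurable_EFinP; apply: measurable_funM; last exact: measurable_funTS.
  by move/integrableP : iq => [/measurable_EFinP].
- move=> t _; rewrite lee_fin /= !normrM mulrC w0.
  by rewrite ler_wpM2r.
- exact: integrableZl.
Qed.

Let cosection_integral s :
  (\int[l]_t ((q \_ D) t * phi (t, s))%:E =
   (\int[l]_(t in D) (q t * phi (t, s)))%:E)%E.
Proof.
rewrite /Rintegral fineK; last first.
  exact: integrable_fin_num (integrable_kernel_section s).
rewrite [in RHS]integral_mkcond; apply: eq_integral => t _.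
by rewrite !patchE; case: ifPn => //; rewrite mul0r.
Qed.

Lemma integrable_kernel_average :
  l.-integrable D (fun t => (q t * \int[m]_s phi (t, s))%:E).
Proof.
apply/(integrable_mkcond _ mD).
have := integrable_fubini_F integrable_kernel_prod.
by apply: eq_integrable => // t _; rewrite /fubini_F/= section_integral !patchE; case: ifPn.
Qed.

Lemma measurable_kernel_integral :
  measurable_fun setT (fun s => \int[l]_(t in D) (q t * phi (t, s))).
Proof.
apply/measurable_EFinP.
have := measurable_fubini_G integrable_kernel_prod.
by apply: eq_measurable_fun => s _; rewrite /fubini_G cosection_integral.
Qed.

Lemma kernel_average_integral :
  \int[l]_(t in D) (q t * \int[m]_s phi (t, s)) =
  \int[m]_s \int[l]_(t in D) (q t * phi (t, s)).
Proof.
have := Fubini integrable_kernel_prod.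
rewrite /Rintegral -[in X in _ -> X](eq_integral _ _ (fun s _ => cosection_integral s)).
move=> /= <-; congr fine; rewrite integral_mkcond; apply: eq_integral => t _ /=.
by rewrite section_integral !patchE; case: ifPn.
Qed.

Lemma kernel_average_le (C : R) :
  (forall s, `|\int[l]_(t in D) (q t * phi (t, s))| <= C * w s) ->
  `|\int[l]_(t in D) (q t * \int[m]_s phi (t, s))| <= C * \int[m]_s w s.
Proof.
move=> bnd; rewrite kernel_average_integral.
have iCw : m.-integrable setT (fun s => (C * w s)%:E).
  have := integrableZl measurableT C iw.
  by apply: eq_integrable => // s _; rewrite EFinM.
have iqf : m.-integrable setT (EFin \o (fun s => \int[l]_(t in D) (q t * phi (t, s)))).
  apply: le_integrable iCw => //; first exact/measurable_EFinP/measurable_kernel_integral.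
  by move=> s _; rewrite lee_fin /= (le_trans (bnd s))// ler_norm.
apply: (le_trans (le_normr_Rintegral measurableT iqf)).
rewrite -RintegralZl//; apply: le_Rintegral => //.
exact: integrable_norm iqf.
Qed.

End fixed_domain.

(** The bound is on the integrals over [D n], not on the integrand: the weight
    [q] may be non-integrable on the union of the [D n], and the cancellation in
    [phi] alone keeps these integrals bounded. *)
Lemma kernel_average_cvg (D : (set T1)^nat) (K : S -> R) (C : R) :
  (forall n, measurable (D n)) -> (forall n, l.-integrable (D n) (EFin \o q)) ->
  (forall n s, `|\int[l]_(t in D n) (q t * phi (t, s))| <= C * w s) ->
  (forall s, \int[l]_(t in D n) (q t * phi (t, s)) @[n --> \oo] --> K s) ->
  m.-integrable setT (EFin \o K) /\
  \int[l]_(t in D n) (q t * \int[m]_s phi (t, s)) @[n --> \oo] --> \int[m]_s K s.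
Proof.
move=> mD iq bnd cvgK.
have mK n := measurable_kernel_integral (mD n) (iq n).
have mK' : measurable_fun setT K.
  by apply: (measurable_fun_cvg mK) => s _; exact: cvgK.
have [iK _ cv] : [/\ m.-integrable setT (EFin \o K),
    (\int[m]_s `|(\int[l]_(t in D n) (q t * phi (t, s)))%:E - (K s)%:E|)%E
      @[n --> \oo] --> 0%E &
    (\int[m]_s (\int[l]_(t in D n) (q t * phi (t, s)))%:E)%E @[n --> \oo] -->
      (\int[m]_s (K s)%:E)%E].
  apply: (@dominated_convergence _ S R m setT measurableT _ _ (fun s => C%:E * (w s)%:E)%E).
  - by move=> n; exact/measurable_EFinP.
  - exact/measurable_EFinP.
  - by apply: aeW => s _; apply: cvg_EFin; [exact: nearW|exact: cvgK].
  - exact: integrableZl.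
  - by apply: aeW => s n _; rewrite lee_fin.
split => //.
under eq_fun do rewrite kernel_average_integral//.
by apply: fine_cvg; rewrite /Rintegral fineK// integrable_fin_num.
Qed.

End averaging.

(** * Principal values of kernels with a parity *)

Lemma cvg_mul0 (R : realType) (f : R -> R) : 0 * f e @[e --> (0 : R)^'+] --> (0 : R).
Proof.
apply: (@cvg_trans _ ((0 : R) @[_ --> (0 : R)^'+])); last exact: cvg_cst.
by apply: near_eq_cvg; near=> e; rewrite mul0r.
Unshelve. all: by end_near. Qed.

Section principal_values.
Context {R : realType}.
Notation lam := (@completed_lebesgue_measure R).

(** A truncated integral that no longer sees its outer end [A] once [T <= A]
    turns the joint limit into a one-sided limit at [0]. *)
Lemma cvg_pv_filterP (f : R * R -> R) (J : R -> R) (T l : R) :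
  (forall e A, 0 < e -> T <= A -> f (e, A) = J e) ->
  f p @[p --> pv_filter] --> l <-> J e @[e --> (0 : R)^'+] --> l.
Proof.
move=> fJ; split => [fl|Jl].
  move=> B /fl [[U V] [/= U0 [M [_ MV]]] UV].
  change (\forall e \near 0^'+, B (J e)); near=> e.
  have e0 : 0 < e by near: e; exact: nbhs_right_gt.
  have := UV (e, Num.max T (M + 1)); rewrite /= fJ//.
    apply; split; first by near: e.
    by apply: MV; rewrite lt_max ltrDl ltr01 orbT.
  by rewrite le_max lexx.
apply: (@cvg_trans _ ((J \o fst) p @[p --> pv_filter])).
  apply: near_eq_cvg.
  exists ([set e | 0 < e], [set A | T <= A]) => /=.
    by split; [exact: nbhs_right_gt|exact: nbhs_pinfty_ge (num_real T)].
  by move=> [e A] [/= e0 TA]; rewrite fJ.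
by apply: cvg_comp Jl; exact: cvg_fst.
Unshelve. all: by end_near. Qed.

Definition cutint (T : R) (r : R -> R) (e : R) : R :=
  \int[lam]_(t in `[e, T]) r t.

Section component.
(** [s] is the parity of [r]: [1] for an even function, [-1] for an odd one. *)
Variables (T : R) (r : R -> R) (s : R).
Hypothesis ir : forall e, 0 < e -> lam.-integrable `[e, T] (EFin \o r).
Hypothesis r0 : forall t, T < t -> r t = 0.
Hypothesis sym : forall t, r (- t) = s * r t.

Let itvE e A : T <= A -> r \_ `[e, A] = r \_ `[e, T].
Proof.
move=> TA; apply/funext => t; rewrite !patchE.
have [tT|tT] := leP t T.
  have -> // : (t \in `[e, A]%classic) = (t \in `[e, T]%classic).
  rewrite !mem_setE/= !in_itv/= tT (le_trans tT TA)//.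
by rewrite r0//; case: ifP => _; case: ifP.
Qed.

Lemma integrable_right e A : 0 < e -> lam.-integrable `[e, A] (EFin \o r).
Proof.
move=> e0; pose B := Num.max A T.
have AB : `[e, A]%classic `<=` `[e, B]%classic.
  by move=> t /=; rewrite !in_itv/= => /andP[-> tA]; rewrite /B le_max tA.
apply: (integrableS (completed_measurable_itv _) (completed_measurable_itv _) AB).
apply/(integrable_mkcond _ (completed_measurable_itv _)).
rewrite restrict_EFin itvE ?le_max ?lexx ?orbT// -restrict_EFin.
by apply/(integrable_mkcond _ (completed_measurable_itv _)); exact: ir.
Qed.

Lemma integral_right e A : T <= A ->
  \int[lam]_(t in `[e, A]) r t = \int[lam]_(t in `[e, T]) r t.
Proof. by move=> TA; rewrite Rintegral_mkcond [RHS]Rintegral_mkcond itvE. Qed.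

Let leftE e A : [set t : R | `[e, A]%classic (-1 * t)] = `[- A, - e]%classic.
Proof.
apply/seteqP; split=> t /=; rewrite !in_itv/= mulN1r => /andP[? ?]; apply/andP.
  by split; [rewrite lerNl|rewrite lerNr].
by split; [rewrite lerNr|rewrite lerNl].
Qed.

Lemma integral_left e A : 0 < e ->
  lam.-integrable `[- A, - e] (EFin \o r) /\
  \int[lam]_(t in `[- A, - e]) r t = s * \int[lam]_(t in `[e, A]) r t.
Proof.
move=> e0; have i1 : lam.-integrable `[e, A] (fun t => (s * r t)%:E).
  have := (integrableZl (completed_measurable_itv _) s (integrable_right A e0)).
  by apply: eq_integrable; [exact: completed_measurable_itv|move=> t _; rewrite EFinM].
have N0 : -1 != 0 :> R by rewrite oppr_eq0 oner_eq0.
have [] := completed_integral_scale N0 (completed_measurable_itv _) i1.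
rewrite leftE normrN1 invr1 mul1r => i2 E2; split.
  move: i2; apply: eq_integrable => [|t _]; first exact: completed_measurable_itv.
  by rewrite /= -sym mulN1r opprK.
rewrite -RintegralZl; [|exact: completed_measurable_itv|exact: integrable_right].
rewrite -E2; apply: eq_Rintegral => t _.
by rewrite -sym mulN1r opprK.
Qed.

Lemma cvg_symmetric_integralP (l : R) :
  (fun p : R * R => \int[lam]_(t in `[- p.2, - p.1]) r t +
                    \int[lam]_(t in `[p.1, p.2]) r t) @ pv_filter --> l <->
  ((1 + s) * cutint T r e) @[e --> 0^'+] --> l.
Proof.
apply: (@cvg_pv_filterP _ _ T) => e A e0 TA /=.
by rewrite (integral_left _ e0).2 integral_right// mulrDl mul1r addrC.
Qed.

End component.

Lemma pv_symmetric_kernel (T : R) (h : R -> R[i]) (s s' lr li : R) :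
  (forall e, 0 < e -> cintegrable lam `[e, T] h) ->
  (forall t, T < t -> h t = 0) ->
  (forall t, complex.Re (h (- t)) = s * complex.Re (h t)) ->
  (forall t, complex.Im (h (- t)) = s' * complex.Im (h t)) ->
  ((1 + s) * cutint T (fun t => complex.Re (h t)) e) @[e --> 0^'+] --> lr ->
  ((1 + s') * cutint T (fun t => complex.Im (h t)) e) @[e --> 0^'+] --> li ->
  pv_exists h /\ pv h = lr +i* li.
Proof.
move=> ih h0 sr si cr ci.
have ihr e : 0 < e -> lam.-integrable `[e, T] (EFin \o (fun t => complex.Re (h t))).
  by move=> /ih[].
have ihi e : 0 < e -> lam.-integrable `[e, T] (EFin \o (fun t => complex.Im (h t))).
  by move=> /ih[].
have hr0 t : T < t -> complex.Re (h t) = 0 by move=> /h0 ->.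
have hi0 t : T < t -> complex.Im (h t) = 0 by move=> /h0 ->.
have {}cr := (cvg_symmetric_integralP ihr hr0 sr _).2 cr.
have {}ci := (cvg_symmetric_integralP ihi hi0 si _).2 ci.
split; last by rewrite /pv /= (cvg_lim _ cr)// (cvg_lim _ ci).
split.
- move=> e A e0 _; split; split.
  + exact: (integral_left ihr hr0 sr _ e0).1.
  + exact: (integral_left ihi hi0 si _ e0).1.
  + exact: (integrable_right ihr hr0).
  + exact: (integrable_right ihi hi0).
- by apply/cvg_ex; exists lr.
- by apply/cvg_ex; exists li.
Qed.

(** The converse of [pv_symmetric_kernel], which extracts one-sided limits from
    a principal value assumed to exist. *)
Lemma pv_symmetric_kernel_cvg (T : R) (h : R -> R[i]) (s s' : R) :
  (forall t, T < t -> h t = 0) ->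
  (forall t, complex.Re (h (- t)) = s * complex.Re (h t)) ->
  (forall t, complex.Im (h (- t)) = s' * complex.Im (h t)) ->
  pv_exists h ->
  (forall e, 0 < e -> cintegrable lam `[e, T] h) /\
  ((1 + s) * cutint T (fun t => complex.Re (h t)) e) @[e --> 0^'+] -->
    complex.Re (pv h) /\
  ((1 + s') * cutint T (fun t => complex.Im (h t)) e) @[e --> 0^'+] -->
    complex.Im (pv h).
Proof.
move=> h0 sr si [ih cr ci].
have ih' e : 0 < e -> cintegrable lam `[e, T] h.
  move=> e0; have eA : e < Num.max T (e + 1) by rewrite lt_max ltrDl ltr01 orbT.
  have sub : `[e, T]%classic `<=` `[e, Num.max T (e + 1)]%classic.
    by move=> t /=; rewrite !in_itv/= => /andP[-> tT]; rewrite le_max tT.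
  have [_ [i1 i2]] := ih e _ e0 eA.
  by split; [apply: integrableS i1|apply: integrableS i2] => //;
    exact: completed_measurable_itv.
have ihr e : 0 < e -> lam.-integrable `[e, T] (EFin \o (fun t => complex.Re (h t))).
  by move=> /ih'[].
have ihi e : 0 < e -> lam.-integrable `[e, T] (EFin \o (fun t => complex.Im (h t))).
  by move=> /ih'[].
have hr0 t : T < t -> complex.Re (h t) = 0 by move=> /h0 ->.
have hi0 t : T < t -> complex.Im (h t) = 0 by move=> /h0 ->.
split; first exact: ih'.
split; [apply: (cvg_symmetric_integralP ihr hr0 sr _).1|
        apply: (cvg_symmetric_integralP ihi hi0 si _).1].
- exact: cr.
- exact: ci.
Qed.

End principal_values.

(** * Trigonometric kernels *)

Section trigonometry.
Context {R : realType}.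

Lemma measurable_sin : measurable_fun setT (@sin R).
Proof. exact: continuous_measurable_fun (@continuous_sin R). Qed.

Lemma measurable_cos : measurable_fun setT (@cos R).
Proof. exact: continuous_measurable_fun (@continuous_cos R). Qed.

Lemma measurable_inv : measurable_fun setT (@GRing.inv R).
Proof.
have oD : open [set t : R | t != 0]  by exact: open_neq.
rewrite (_ : setT = [set t : R | t != 0] `|` [set 0]); last first.
  by apply/seteqP; split=> // t _; have [->|t0] := eqVneq t 0; [right|left].
apply/measurable_funU; [exact: open_measurable|by []|split].
  apply: open_continuous_measurable_fun => // t; rewrite inE/= => t0.
  exact: inv_continuous.
exact: measurable_fun_set1.
Qed.

Lemma sin_norm_le (x : R) : `|sin x| <= `|x|.
Proof.
wlog x0 : x / 0 < x.
  move=> H; have [x0|x0|->] := ltrgtP x 0; last by rewrite sin0.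
    by rewrite -normrN -sinN -(normrN x) H// oppr_gt0.
  exact: H.
have [|c _] := @MVT R (@sin R) (@cos R) 0 x x0 (fun y _ => is_derive_sin y).
  by apply: continuous_subspaceT => y; exact: continuous_sin.
rewrite sin0 !subr0 => ->; rewrite normrM ler_piMl//.
exact: cos_max.
Qed.

End trigonometry.

Section complex_kernel.
Context {R : realType}.
Implicit Types (f : R -> R[i]) (x t : R).

Lemma divC_complex (z : R[i]) t :
  z / t%:C = (complex.Re z / t) +i* (complex.Im z / t).
Proof. by case: z => a b; rewrite -fmorphV; congr Complex; rewrite /=; ring. Qed.

Lemma Re_Gkernel f x t : complex.Re (Gkernel f x t) =
  (cos (t * x) * complex.Re (f t) + sin (t * x) * complex.Im (f t)) / t.
Proof.
rewrite /Gkernel /expi divC_complex; case: (f t) => a b /=.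
by rewrite cosN sinN mulNr opprK.
Qed.

Lemma Im_Gkernel f x t : complex.Im (Gkernel f x t) =
  (cos (t * x) * complex.Im (f t) - sin (t * x) * complex.Re (f t)) / t.
Proof.
rewrite /Gkernel /expi divC_complex; case: (f t) => a b /=.
by rewrite cosN sinN mulNr.
Qed.

Lemma G_of_pv f x lr li : pv (Gkernel f x) = lr +i* li ->
  G f x = (- (li / (2 * pi))) +i* (lr / (2 * pi)).
Proof.
rewrite /G => ->; rewrite divC_complex /=; congr Complex; ring.
Qed.

End complex_kernel.

(** * The unit step distribution *)

Section heaviside.
Context {R : realType}.

Definition heaviside (y : R) : R := (0 <= y)%R%:R.

Lemma heaviside_nondecreasing : {homo heaviside : x y / x <= y}.
Proof.
move=> x y xy; rewrite /heaviside ler_nat.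
by case: (leP 0 x) => // /le_trans ->.
Qed.

Lemma heaviside_right_continuous : right_continuous heaviside.
Proof.
move=> x; apply: (@cvg_trans _ (heaviside x @[_ --> x^'+])); last exact: cvg_cst.
apply: near_eq_cvg; rewrite /heaviside; have [x0|x0] := leP 0 x; near=> y.
  by rewrite (le_trans x0)//; apply: ltW; near: y; exact: nbhs_right_gt.
have y0 : y < 0 by near: y; exact: nbhs_right_lt.
by rewrite (lt_geF y0).
Unshelve. all: by end_near. Qed.

Lemma measurable_heaviside : measurable_fun setT heaviside.
Proof.
rewrite (_ : heaviside = \1_(`[0, +oo[%classic)); first exact: measurable_indic.
by apply/funext => u; rewrite /heaviside indicE mem_setE in_itv/= andbT.
Qed.

HB.instance Definition _ := isCumulative.Build R _ R heaviside
  heaviside_nondecreasing heaviside_right_continuous.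

Lemma heaviside_cvgNy : heaviside @ -oo --> (0 : R).
Proof.
apply: (@cvg_trans _ ((0 : R) @[_ --> -oo])); last exact: cvg_cst.
apply: near_eq_cvg; near=> y.
have y0 : y < 0 by near: y; exact: nbhs_ninfty_lt.
by rewrite /heaviside (lt_geF y0).
Unshelve. all: by end_near. Qed.

Lemma heaviside_cvgy : heaviside @ +oo --> (1 : R).
Proof.
apply: (@cvg_trans _ ((1 : R) @[_ --> +oo])); last exact: cvg_cst.
apply: near_eq_cvg; near=> y.
have y0 : 0 <= y by near: y; exact: nbhs_pinfty_ge.
by rewrite /heaviside y0.
Unshelve. all: by end_near. Qed.

HB.instance Definition _ :=
  isCumulativeBounded.Build R 0 1 heaviside heaviside_cvgNy heaviside_cvgy.

Lemma heaviside_flim_left (x : R) : flim_left heaviside x = (0 < x)%R%:R.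
Proof.
apply: cvg_lim => //.
apply: (@cvg_trans _ ((0 < x)%R%:R @[_ --> x^'-])); last exact: cvg_cst.
apply: near_eq_cvg; rewrite /heaviside; have [x0|x0] := ltP 0 x; near=> y.
  have y0 : 0 <= y by near: y; exact: nbhs_left_ge.
  by rewrite y0.
have y0 : y < 0 by apply: lt_le_trans x0; near: y; exact: nbhs_left_lt.
by rewrite (lt_geF y0).
Unshelve. all: by end_near. Qed.

Lemma heaviside_flim_right (x : R) : flim_right heaviside x = (0 <= x)%R%:R.
Proof. by apply: cvg_lim => //; exact: heaviside_right_continuous. Qed.

Lemma heaviside_flim_infty : flim_infty heaviside = 1.
Proof. by apply: cvg_lim => //; exact: heaviside_cvgy. Qed.

Lemma lebesgue_stieltjes_heaviside (A : set R) : measurable A ->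
  lebesgue_stieltjes_measure heaviside A = \d_(0 : R) A.
Proof.
move=> mA; have := @lebesgue_stieltjes_measure_unique R heaviside
  (@dirac _ (measurableTypeR R) (0 : R) R : {measure set (measurableTypeR R) -> \bar R}).
move=> /(_ _ A mA); apply => I [[a b] _ <-].
rewrite /lebesgue_stieltjes_measure /measure_extension/=.
rewrite measurable_mu_extE/=; last exact: is_ocitv.
have [ab|ba] := leP a b; last first.
  by rewrite set_itv_ge ?wlength0 ?measure0// bnd_simp -leNgt ltW.
rewrite wlength_itv_bnd// diracE mem_setE in_itv/= /heaviside; congr EFin.
have [a0|a0] := ltP a 0; first by rewrite subr0.
by rewrite (le_trans a0 ab) subrr.
Qed.

Lemma charf_heaviside (t : R) : charf heaviside t = 1.
Proof.
rewrite /charf /cintegral /Rintegral.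
have E (f : R -> R) : measurable_fun setT f ->
    (\int[lebesgue_stieltjes_measure heaviside]_y (f y)%:E = (f 0)%:E)%E.
  move=> mf; rewrite (eq_measure_integral (@dirac _ (measurableTypeR R) (0 : R) R)); last first.
    by move=> A mA _; exact: lebesgue_stieltjes_heaviside.
  rewrite integral_dirac ?diracT ?mul1e//.
  exact/measurable_EFinP.
have mt : measurable_fun setT (fun y : R => t * y) by exact: mulrl_measurable.
rewrite (E (fun y => cos (t * y))) ?(E (fun y => sin (t * y)))/=.
- by rewrite mulr0 sin0 cos0.
- exact: measurableT_comp (@measurable_sin R) mt.
- exact: measurableT_comp (@measurable_cos R) mt.
Qed.

End heaviside.

(** * Smoothing the unit step *)

Section smoothing.
Context {R : realType}.
Notation lam := (@completed_lebesgue_measure R).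
Variable M : R -> R[i].
Hypothesis ha : smoothing_inequalities M.
Hypothesis hb : forall t : R, 1 < `|t| -> M t = 0.
Hypothesis hc : forall t : R, M1 M (- t) = M1 M t /\ M2 M (- t) = - M2 M t.
Variable T : R.
Hypothesis hT : 0 < T.

Definition sin_weight (t : R) : R := M1 M (t / T) / t.
Definition cos_weight (t : R) : R := M2 M (t / T) / t.

Lemma filter_eq0 t : T < t -> M (t / T) = 0.
Proof.
by move=> Tt; apply: hb; rewrite (lt_le_trans _ (ler_norm _))// ltr_pdivlMr// mul1r.
Qed.

Lemma sin_weight_eq0 t : T < t -> sin_weight t = 0.
Proof. by move=> /filter_eq0; rewrite /sin_weight /M1 => ->; rewrite mul0r. Qed.

Lemma cos_weight_eq0 t : T < t -> cos_weight t = 0.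
Proof. by move=> /filter_eq0; rewrite /cos_weight /M2 => ->; rewrite mul0r. Qed.

Lemma sin_weightN t : sin_weight (- t) = - sin_weight t.
Proof. by rewrite /sin_weight mulNr (hc _).1 invrN mulrN. Qed.

Lemma cos_weightN t : cos_weight (- t) = cos_weight t.
Proof. by rewrite /cos_weight mulNr (hc _).2 invrN mulrNN. Qed.

(** The truncated transforms [a_e u] and [b_e u]. *)
Definition sin_cut (e u : R) : R := cutint T (fun t => sin_weight t * sin (t * u)) e.
Definition cos_cut (e u : R) : R := cutint T (fun t => cos_weight t * cos (t * u)) e.

(* [s = 1] for the weight [M (t / T)] of the upper bound, and [s = -1] for the
   weight [M (- t / T)] of the lower bound, which is its conjugate. *)
Let step_transform (s : R) (N : R -> R[i]) u :
  (forall t, complex.Re (N t) = M1 M (t / T)) ->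
  (forall t, complex.Im (N t) = s * M2 M (t / T)) ->
  (forall e, 0 < e -> lam.-integrable `[e, T] (EFin \o sin_weight) /\
    lam.-integrable `[e, T] (EFin \o cos_weight)) ->
  Gexists (fun t => N t * charf heaviside t) u ->
  exists l : R, ((s * cos_cut e u - sin_cut e u) @[e --> 0^'+] --> l) /\
    G (fun t => N t * charf heaviside t) u = (- (l / pi))%:C.
Proof.
move=> N1 N2 iw.
have -> : (fun t => N t * charf heaviside t) = N.
  by apply/funext => t; rewrite charf_heaviside mulr1.
set h := Gkernel N u => eh.
have Reh t : complex.Re (h t) =
    sin_weight t * cos (t * u) + s * (cos_weight t * sin (t * u)).
  by rewrite Re_Gkernel N1 N2 /sin_weight /cos_weight; ring.
have Imh t : complex.Im (h t) =
    s * (cos_weight t * cos (t * u)) - sin_weight t * sin (t * u).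
  by rewrite Im_Gkernel N1 N2 /sin_weight /cos_weight; ring.
have h0 t : T < t -> h t = 0.
  move=> Tt; apply/eqP; rewrite eq_complex Reh Imh.
  by rewrite sin_weight_eq0// cos_weight_eq0// !mul0r !mulr0 subr0 addr0 eqxx.
have ReN t : complex.Re (h (- t)) = -1 * complex.Re (h t).
  by rewrite !Reh sin_weightN cos_weightN !mulNr cosN sinN; ring.
have ImN t : complex.Im (h (- t)) = 1 * complex.Im (h t).
  by rewrite !Imh sin_weightN cos_weightN !mulNr cosN sinN; ring.
have [_ [cr ci]] := pv_symmetric_kernel_cvg h0 ReN ImN eh.
exists (complex.Im (pv h) / 2); split.
  apply: (@cvg_trans _ ((1 + 1) * cutint T (fun t => complex.Im (h t)) e / 2
    @[e --> 0^'+])); last exact: cvgMl.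
  apply: near_eq_cvg; near=> e.
  have e0 : 0 < e by near: e; exact: nbhs_right_gt.
  have [i1 i2] := iw e e0.
  rewrite (funext Imh) /cutint.
  have mD := completed_measurable_itv `[e, T].
  have i1' := integrable_mul_bounded mD i1
    (measurableT_comp (@measurable_sin R) (mulrr_measurable u)) (fun t => sin_max _).
  have i2' := integrable_mul_bounded mD i2
    (measurableT_comp (@measurable_cos R) (mulrr_measurable u)) (fun t => cos_max _).
  have i2s : lam.-integrable `[e, T] (fun t => (s * (cos_weight t * cos (t * u)))%:E).
    have := integrableZl mD s i2'.
    by apply: eq_integrable => // t _; rewrite EFinM.
  rewrite (RintegralB mD i2s i1') (RintegralZl s mD i2').
  by rewrite /cos_cut /sin_cut /cutint; field.
have pr : complex.Re (pv h) = 0.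
  apply/esym; apply: cvg_unique cr => //.
  by rewrite subrr; exact: cvg_mul0.
rewrite (@G_of_pv _ _ _ (complex.Re (pv h)) (complex.Im (pv h))).
  by rewrite pr mul0r invfM mulrA.
by case: (pv h).
Unshelve. all: by end_near. Qed.

Let mirror_arg t : - t / T = - (t / T). Proof. by rewrite mulNr. Qed.

(** The existence of the principal value at [u = 0], for the unit mass at [0],
    contains this integrability. *)
Lemma weights_integrable e : 0 < e ->
  lam.-integrable `[e, T] (EFin \o sin_weight) /\
  lam.-integrable `[e, T] (EFin \o cos_weight).
Proof.
have [[_ ex] _ _ _] := ha heaviside 0 hT.
pose h := Gkernel (fun t => M (t / T) * charf heaviside t) 0.
have Reh t : complex.Re (h t) = sin_weight t.
  rewrite /h Re_Gkernel charf_heaviside mulr1 mulr0 cos0 sin0.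
  by rewrite mul0r mul1r addr0.
have Imh t : complex.Im (h t) = cos_weight t.
  rewrite /h Im_Gkernel charf_heaviside mulr1 mulr0 cos0 sin0.
  by rewrite mul0r mul1r subr0.
have h0 t : T < t -> h t = 0.
  move=> Tt; apply/eqP; rewrite eq_complex Reh Imh.
  by rewrite sin_weight_eq0// cos_weight_eq0// eqxx.
have ReN t : complex.Re (h (- t)) = -1 * complex.Re (h t).
  by rewrite !Reh sin_weightN mulN1r.
have ImN t : complex.Im (h (- t)) = 1 * complex.Im (h t).
  by rewrite !Imh cos_weightN mul1r.
have [ih _] := pv_symmetric_kernel_cvg h0 ReN ImN ex.
have mD := completed_measurable_itv `[e, T].
by move=> /ih[i1 i2]; split; [move: i1|move: i2];
  apply: eq_integrable => // t _; rewrite (Reh, Imh).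
Qed.

Definition sin_lim (u : R) : R := lim (sin_cut ^~ u @ 0^'+).
Definition cos_lim (u : R) : R := lim (cos_cut ^~ u @ 0^'+).

(** The smoothing hypothesis for the unit mass at [0].  The transforms are those
    of [M (t / T)] and of its conjugate [M (- t / T)]; their half-sum and
    half-difference separate the sine part from the cosine part. *)
Lemma dirac_smoothing u :
  [/\ sin_cut e u @[e --> 0^'+] --> sin_lim u,
      cos_cut e u @[e --> 0^'+] --> cos_lim u,
      2^-1 + (sin_lim u + cos_lim u) / pi <= (0 < u)%R%:R &
      (0 <= u)%R%:R <= 2^-1 + (sin_lim u - cos_lim u) / pi].
Proof.
have [[ex1 ex2] le1 _ le2] := ha heaviside u hT.
have [l1 [c1 E1]] := @step_transform (-1) (fun t => M (- t / T)) u
  (fun t => etrans (congr1 (M1 M) (mirror_arg t)) (hc _).1)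
  (fun t => etrans (etrans (congr1 (M2 M) (mirror_arg t)) (hc _).2) (esym (mulN1r _)))
  weights_integrable ex1.
have [l2 [c2 E2]] := @step_transform 1 (fun t => M (t / T)) u
  (fun t => erefl) (fun t => esym (mul1r _)) weights_integrable ex2.
have ca : sin_cut e u @[e --> 0^'+] --> - (l1 + l2) / 2.
  apply: (@cvg_trans _ (- ((-1 * cos_cut e u - sin_cut e u) +
      (1 * cos_cut e u - sin_cut e u)) / 2 @[e --> 0^'+])).
    by apply: near_eq_cvg; near=> e; field.
  by apply: cvgMl; apply: cvgN; exact: cvgD.
have cb : cos_cut e u @[e --> 0^'+] --> (l2 - l1) / 2.
  apply: (@cvg_trans _ (((1 * cos_cut e u - sin_cut e u) -
      (-1 * cos_cut e u - sin_cut e u)) / 2 @[e --> 0^'+])).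
    by apply: near_eq_cvg; near=> e; field.
  by apply: cvgMl; exact: cvgB.
have Ea : sin_lim u = - (l1 + l2) / 2 by exact: cvg_lim.
have Eb : cos_lim u = (l2 - l1) / 2 by exact: cvg_lim.
rewrite Ea Eb; split => //.
- move: le1; rewrite E1 heaviside_flim_left heaviside_flim_infty mulr1.
  rewrite lecE /= => /andP[_]; congr (_ <= _); congr (_ + _).
  by rewrite -mulNr; congr (_ / _); field.
- move: le2; rewrite E2 heaviside_flim_right heaviside_flim_infty mulr1.
  rewrite lecE /= => /andP[_]; congr (_ <= _); congr (_ + _).
  by rewrite -mulNr; congr (_ / _); field.
Unshelve. all: by end_near. Qed.

End smoothing.

(** * The sine integral and uniform bounds *)

Section sine_integral.
Context {R : realType}.
Notation lam := (@completed_lebesgue_measure R).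

(** [sinc v t] is [v] times the usual cardinal sine at [t v], except at [t = 0],
    where it is [0]; only its integrals matter. *)
Definition sinc (v t : R) : R := sin (t * v) / t.

Lemma sinc_le v t : `|sinc v t| <= `|v|.
Proof.
rewrite /sinc normrM normfV; have [->|t0] := eqVneq t 0.
  by rewrite normr0 invr0 mulr0.
by rewrite ler_pdivrMr ?normr_gt0// -normrM (mulrC v) sin_norm_le.
Qed.

Lemma measurable_sinc v : measurable_fun setT (sinc v).
Proof.
apply: measurable_funM; last exact: measurable_inv.
exact: measurableT_comp measurable_sin (mulrr_measurable v).
Qed.

Lemma integrable_sinc v (i : interval R) (a b : R) : [set` i] `<=` `[a, b]%classic ->
  lam.-integrable [set` i] (EFin \o sinc v).
Proof.
exact: integrable_bounded_itv (measurable_sinc v) (sinc_le v).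
Qed.

Lemma norm_integral_sinc_near0 v (e : R) : 0 <= e ->
  `|\int[lam]_(t in `[0, e[) sinc v t| <= `|v| * e.
Proof.
move=> e0; have mD := completed_measurable_itv `[0, e[.
have si : [set` `[0, e[] `<=` `[0, e]%classic by exact: subset_itv_co_cc.
have iv := integrable_sinc v si.
apply: (le_trans (le_normr_Rintegral mD iv)).
apply: (@le_trans _ _ (\int[lam]_(t in `[0, e[) `|v|)).
  apply: le_Rintegral => //; first exact: integrable_norm.
    by apply: (integrable_bounded_itv (B := `|v|)) si => // t; rewrite normr_id.
  by move=> t _; exact: sinc_le.
rewrite Rintegral_cst//= completed_lebesgue_measure_itv/=.
by rewrite lte_fin; case: ltP => [_|e0']/=; rewrite ?subr0// mulr0 mulr_ge0.
Qed.

Lemma integral_sinc_co v (T : R) : 0 <= T ->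
  \int[lam]_(t in `[0, T]) sinc v t = \int[lam]_(t in `[0, T[) sinc v t.
Proof.
move=> T0; rewrite (@Rintegral_setU_itv _ _ `[0, T[ `[T, T]).
- have mT := completed_measurable_itv `[T, T].
  have mS : measurable_fun (`[T, T] : set (completed_line R)) (EFin \o sinc v).
    by apply/measurable_EFinP; exact: completed_measurable_fun mT (measurable_sinc v).
  have T0m : lam `[T, T] = 0%E by rewrite completed_lebesgue_measure_itv/= ltxx.
  have := null_set_integral mT mS T0m.
  by rewrite /Rintegral => /= ->; rewrite addr0.
- apply/seteqP; split => t /=; rewrite !in_itv/=.
    move=> /andP[t0 tT]; have [_|_] := ltP t T; first by left; rewrite t0.
    by right; rewrite tT.
  by move=> [/andP[-> /ltW]//|]; rewrite -eq_le => /eqP <-; rewrite T0 lexx.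
- by rewrite -subset0 => t /= []; rewrite !in_itv/= => /andP[_ /lt_geF ->].
- exact: (@integrable_sinc _ _ 0 T).
Qed.

(** The sine integral depends on the product of its endpoint and frequency. *)
Lemma integral_sinc_scale v (e T : R) : 0 < e -> 0 < T ->
  \int[lam]_(t in `[0, e[) sinc v t = \int[lam]_(t in `[0, T[) sinc (e / T * v) t.
Proof.
move=> e0 T0; pose c := e / T.
have c0 : 0 < c by rewrite divr_gt0.
have cn0 : c != 0 by rewrite gt_eqF.
have si : [set` `[0, e[] `<=` `[0, e]%classic by exact: subset_itv_co_cc.
have [_] := completed_integral_scale cn0 (completed_measurable_itv `[0, e[)
  (integrable_sinc v si).
have -> : [set t : R | [set` `[0, e[] (c * t)] = [set` `[0, T[].
  apply/seteqP; split => t /=; rewrite !in_itv/= pmulr_rge0//;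
    by rewrite /c mulrAC ltr_pdivrMr// ltr_pM2l.
have E t : sinc v (c * t) = c^-1 * sinc (c * v) t.
  by rewrite /sinc invfM mulrCA; congr (_ * (sin _ / _)); ring.
under eq_Rintegral do rewrite E.
rewrite RintegralZl; last 2 first.
- exact: completed_measurable_itv.
- by apply: (@integrable_sinc _ _ 0 T); exact: subset_itv_co_cc.
by rewrite gtr0_norm// => /mulfI <- //; rewrite invr_eq0.
Qed.

End sine_integral.

Section uniform_bounds.
Context {R : realType}.
Notation lam := (@completed_lebesgue_measure R).
Variable M : R -> R[i].
Hypothesis ha : smoothing_inequalities M.
Hypothesis hb : forall t : R, 1 < `|t| -> M t = 0.
Hypothesis hc : forall t : R, M1 M (- t) = M1 M t /\ M2 M (- t) = - M2 M t.
Hypothesis hd : exists kappa : R,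
     cintegrable completed_lebesgue_measure `[-1, 1]
       (fun t : R => (M t - kappa%:C) / t%:C).
Variable T : R.
Hypothesis hT : 0 < T.

Lemma weights_integrable_near0 : exists kappa : R,
  lam.-integrable `[0, T] (fun t => (sin_weight M T t - kappa / t)%:E) /\
  lam.-integrable `[0, T] (EFin \o cos_weight M T).
Proof.
have [kappa [i1 i2]] := hd; exists kappa.
have T0 : T != 0 by rewrite gt_eqF.
have V0 : T^-1 != 0 by rewrite invr_eq0.
have m01 := completed_measurable_itv `[(0 : R), 1].
have mT := completed_measurable_itv `[0, T].
have s01 : `[0, 1]%classic `<=` (`[-1, 1]%classic : set R).
  by apply: subset_itvr; rewrite bnd_simp lerN10.
have dom : [set t : R | [set` `[0, 1]] (T^-1 * t)] = [set` `[0, T]].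
  apply/seteqP; split => t /=; rewrite !in_itv/= pmulr_rge0 ?invr_gt0//;
    by rewrite ler_pdivrMl// mulr1.
have m11 := completed_measurable_itv `[(-1 : R), 1].
have scale (f g : R -> R) : lam.-integrable `[-1, 1] (EFin \o f) ->
    (forall t, T^-1 * f (T^-1 * t) = g t) -> lam.-integrable `[0, T] (EFin \o g).
  move=> iF fg.
  have [+ _] := completed_integral_scale V0 m01 (integrableS m11 m01 s01 iF).
  rewrite dom => ifT.
  have := integrableZl mT T^-1 ifT.
  by apply: eq_integrable => // t _; rewrite /= -fg EFinM.
split.
- apply: (scale _ _ i1) => t; rewrite divC_complex /= /sin_weight /M1 (mulrC t).
  case: (M _) => a b /=.
  by rewrite invfM invrK mulrCA mulKf// mulrBl.
- apply: (scale (fun t => complex.Im ((M t - kappa%:C) / t%:C)) _ i2) => t.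
  rewrite divC_complex /= /cos_weight /M2 (mulrC t).
  case: (M _) => a b /=.
  by rewrite oppr0 addr0 invfM invrK mulrCA mulKf.
Qed.

Let cut_split kappa e u : 0 < e ->
  lam.-integrable `[0, T] (fun t => (sin_weight M T t - kappa / t)%:E) ->
  sin_cut M T e u = \int[lam]_(t in `[e, T]) ((sin_weight M T t - kappa / t) * sin (t * u))
    + kappa * \int[lam]_(t in `[e, T]) sinc u t.
Proof.
move=> e0 ip.
have mD := completed_measurable_itv `[e, T].
have m0 := completed_measurable_itv `[0, T].
have sub : `[e, T]%classic `<=` `[0, T]%classic.
  by apply: subset_itvr; rewrite bnd_simp ltW.
have ipe : lam.-integrable `[e, T] (EFin \o (fun t => sin_weight M T t - kappa / t)).
  exact: integrableS ip.
have ms : measurable_fun setT (fun t : R => sin (t * u)).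
  exact: measurableT_comp measurable_sin (mulrr_measurable u).
have ips := integrable_mul_bounded mD ipe ms (fun t => sin_max (t * u)).
have isc := integrable_sinc u sub.
rewrite -(RintegralZl kappa mD isc) -(RintegralD mD ips); last first.
  have := integrableZl mD kappa isc.
  by apply: eq_integrable => // t _; rewrite EFinM.
rewrite /sin_cut /cutint; apply: eq_Rintegral => t _.
by rewrite /sinc; ring.
Qed.

Let sinc_split (e u : R) : 0 < e -> e <= T ->
  \int[lam]_(t in `[0, T]) sinc u t =
  \int[lam]_(t in `[0, e[) sinc u t + \int[lam]_(t in `[e, T]) sinc u t.
Proof.
move=> e0 eT; apply: Rintegral_setU_itv.
- apply/seteqP; split => t /=; rewrite !in_itv/=.
    by move=> /andP[-> ->]; have [|] := ltP t e; [left|right].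
  move=> [/andP[-> te]|/andP[et ->]].
    by rewrite (le_trans (ltW te)).
  by rewrite (le_trans (ltW e0)).
- by rewrite -subset0 => t /= []; rewrite !in_itv/= => /andP[_ /lt_geF ->].
- exact: (@integrable_sinc _ _ _ 0 T).
Qed.

Let limit_bound (a b s c C r : R) : `|a - s| <= 1 -> `|b - c| <= 1 ->
  a + b <= r -> - r <= a - b -> `|c| <= C -> `|s| <= r + C + 2.
Proof.
rewrite !ler_norml => /andP[? ?] /andP[? ?] ? ? /andP[? ?].
by apply/andP; split; lra.
Qed.

(** Up to an integral dominated by that of [|q1 t - kappa / t|], [a_e u] is
    [kappa] times the integral of [sinc u] over [[e, T]], and by dilation the
    latter is [S u - S (e u / T)] with [S u] the integral of [sinc u] over
    [[0, T]].  So it is enough to bound [kappa * S], and this follows from the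
    convergence of [a_e u] to a limit that [dirac_smoothing] bounds
    independently of [u]. *)
Lemma cut_bounded : exists C : R, forall e u, 0 < e ->
  `|sin_cut M T e u| <= C /\ `|cos_cut M T e u| <= C.
Proof.
have [kappa [ip iq]] := weights_integrable_near0.
pose p t := sin_weight M T t - kappa / t.
pose Cp := \int[lam]_(t in `[0, T]) `|p t|.
pose Cq := \int[lam]_(t in `[0, T]) `|cos_weight M T t|.
have sub e : 0 < e -> `[e, T]%classic `<=` `[0, T]%classic.
  by move=> e0; apply: subset_itvr; rewrite bnd_simp ltW.
have mD e := completed_measurable_itv `[e, T].
have Bq e u : 0 < e -> `|cos_cut M T e u| <= Cq.
  move=> e0; apply: (le_norm_integral_bounded (mD e) (mD 0) (sub e e0) iq).
    exact: measurableT_comp measurable_cos (mulrr_measurable u).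
  by move=> t; exact: cos_max.
have Bp e u : 0 < e -> `|\int[lam]_(t in `[e, T]) (p t * sin (t * u))| <= Cp.
  move=> e0; apply: (le_norm_integral_bounded (mD e) (mD 0) (sub e e0) ip).
    exact: measurableT_comp measurable_sin (mulrr_measurable u).
  by move=> t; exact: sin_max.
pose S v := \int[lam]_(t in `[0, T[) sinc v t.
have [C BS] : exists C, forall v, `|kappa * S v| <= C.
  exists (`|kappa| + (pi / 2 + Cq + 2 + Cp)) => v.
  have [ca cb le1 le2] := dirac_smoothing ha hb hc hT v.
  set a := sin_lim M T v in ca le1 le2; set b := cos_lim M T v in cb le1 le2.
  have pi0 : 0 < pi :> R := pi_gt0 R.
  have {}le1 : a + b <= pi / 2.
    have : (a + b) / pi <= 1 - 2^-1.
      by rewrite lerBrDl (le_trans le1)//; case: (0 < v).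
    by rewrite ler_pdivrMr//; lra.
  have {}le2 : - (pi / 2) <= a - b.
    have : 0 - 2^-1 <= (a - b) / pi.
      by rewrite lerBlDl (le_trans _ le2)//; case: (0 <= v).
    by rewrite ler_pdivlMr//; lra.
  (* [e] so small that [a_e v], [b_e v] are close to their limits and the part
     of [S v] over [[0, e]] is at most [1] *)
  near (0 : R)^'+ => e.
  have e0 : 0 < e by near: e; exact: nbhs_right_gt.
  have eT : e <= T by apply: ltW; near: e; exact: nbhs_right_lt.
  have ev : `|v| * e <= 1.
    have : e <= (`|v| + 1)^-1.
      by apply: ltW; near: e; apply: nbhs_right_lt; rewrite invr_gt0 ltr_wpDl.
    rewrite -[_^-1]mul1r ler_pdivlMr ?ltr_wpDl// mulrDr mulr1 mulrC.
    by apply: le_trans; rewrite lerDl ltW.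
  have da : `|a - sin_cut M T e v| <= 1.
    by near: e; move/cvgrPdist_le : ca; apply.
  have db : `|b - cos_cut M T e v| <= 1.
    by near: e; move/cvgrPdist_le : cb; apply.
  have := cut_split v e0 ip.
  have := sinc_split v e0 eT.
  rewrite (integral_sinc_co _ (ltW hT)) -/(S v) => -> cutE.
  have s0 := norm_integral_sinc_near0 v (ltW e0).
  rewrite mulrDr; apply: (le_trans (ler_normD _ _)); apply: lerD.
    by rewrite normrM ler_piMr// (le_trans s0).
  have -> : kappa * \int[lam]_(t in `[e, T]) sinc v t =
      sin_cut M T e v - \int[lam]_(t in `[e, T]) (p t * sin (t * v)).
    by rewrite cutE /p; ring.
  apply: (le_trans (ler_normB _ _)); apply: lerD; last exact: Bp.
  exact: limit_bound da db le1 le2 (Bq e v e0).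
exists (Cq + (Cp + (C + C))) => e u e0.
have C0 : 0 <= C by exact: le_trans (BS 0).
have Cp0 : 0 <= Cp by exact: le_trans (Bp e u e0).
have Cq0 : 0 <= Cq by exact: le_trans (Bq e u e0).
split; last by apply: (le_trans (Bq e u e0)); rewrite lerDl !addr_ge0.
have [eT|Te] := leP e T; last first.
  rewrite /sin_cut /cutint set_itv_ge ?Rintegral_set0 ?normr0 ?addr_ge0//.
  by rewrite bnd_simp -ltNge.
rewrite (cut_split _ e0 ip).
have := sinc_split u e0 eT.
rewrite (integral_sinc_co _ (ltW hT)) (integral_sinc_scale _ e0 hT).
rewrite -/(S _) -/(S _) => SE.
have -> : \int[lam]_(t in `[e, T]) sinc u t = S u - S (e / T * u) by rewrite SE; ring.
apply: (le_trans (ler_normD _ _)); rewrite -[leLHS]add0r; apply: lerD => //.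
apply: lerD; first exact: Bp.
rewrite mulrBr; apply: (le_trans (ler_normB _ _)); exact: lerD.
Unshelve. all: by end_near. Qed.

End uniform_bounds.

(** * Averaging over a power law *)

Section power_density.
Context {R : realType}.
Notation leb := (@lebesgue_measure R).
Variable k : nat.
Hypothesis hk : (1 <= k)%N.

Definition power_density (a : R) : R := k%:R * a ^+ k.-1.

Lemma measurable_power_density : measurable_fun setT power_density.
Proof. by apply: measurable_funM => //; exact: measurable_funX. Qed.

Lemma integral_power_density (r : R) : 0 <= r ->
  (\int[leb]_(a in `[0%R, r]) (power_density a)%:E = (r ^+ k)%:E)%E.
Proof.
rewrite le_eqVlt => /predU1P[<-|r0].
  by rewrite set_itv1 integral_set1 expr0n (gtn_eqF hk).
rewrite (@continuous_FTC2 _ _ (fun x => x ^+ k))//.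
- by rewrite expr0n (gtn_eqF hk) sube0.
- apply: continuous_subspaceT => a.
  by apply: cvgMr; exact: exprn_continuous.
- split => [a _||].
  + exact: exprn_derivable.
  + by apply: cvg_at_right_filter; exact: exprn_continuous.
  + by apply: cvg_at_left_filter; exact: exprn_continuous.
- by move=> a _; rewrite exp_derive1.
Qed.

(** [power_density] is cut off outside [[0, 1]], so that averages over [A] are
    integrals over the whole line, to which Fubini applies. *)
Definition unit_weight (a : R) : R := (power_density \_ `[0, 1]) a.

Lemma unit_weight_ge0 a : 0 <= unit_weight a.
Proof.
rewrite /unit_weight patchE; case: ifPn => // /set_mem/=; rewrite in_itv/= => /andP[a0 _].
by rewrite mulr_ge0// exprn_ge0.
Qed.

Lemma measurable_unit_weight : measurable_fun setT unit_weight.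
Proof.
apply/(measurable_restrictT _ _).1 => //.
exact: measurable_funTS measurable_power_density.
Qed.

Lemma integral_unit_weight : (\int[leb]_a (unit_weight a)%:E = 1)%E.
Proof.
transitivity ((1 ^+ k : R)%:E); last by rewrite expr1n.
rewrite -(integral_power_density ler01) [RHS]integral_mkcond; apply: eq_integral => a _.
by rewrite /unit_weight !patchE; case: ifP.
Qed.

Lemma integrable_unit_weight : leb.-integrable setT (EFin \o unit_weight).
Proof.
apply/integrableP; split; first by apply/measurable_EFinP; exact: measurable_unit_weight.
under eq_integral do rewrite /= ger0_norm ?unit_weight_ge0//.
by rewrite integral_unit_weight ltry.
Qed.

End power_density.

Section cut_average.
Context {R : realType}.
Notation lam := (@completed_lebesgue_measure R).
Notation cR := (completed_line R).
Variables (T : R) (q : R -> R).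
Hypothesis iq : forall e, 0 < e -> lam.-integrable `[e, T] (EFin \o q).

Section one_average.
Context d (S : measurableType d) (m : {sigma_finite_measure set S -> \bar R}).
Variables (phi : cR * S -> R) (w : S -> R).
Hypothesis mphi : measurable_fun setT phi.
Hypothesis phiw : forall t s, `|phi (t, s)| <= w s.
Hypothesis iw : m.-integrable setT (EFin \o w).

Lemma integrable_cut_average e : 0 < e ->
  lam.-integrable `[e, T] (fun t => (q t * \int[m]_s phi (t, s))%:E).
Proof.
move=> e0.
exact: (integrable_kernel_average mphi phiw iw (completed_measurable_itv _) (iq e0)).
Qed.

Lemma cut_average_cvg (K : S -> R) (C : R) :
  (forall e s, 0 < e -> `|cutint T (fun t => q t * phi (t, s)) e| <= C * w s) ->
  (forall s, cutint T (fun t => q t * phi (t, s)) e @[e --> 0^'+] --> K s) ->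
  m.-integrable setT (EFin \o K) /\
  cutint T (fun t => q t * \int[m]_s phi (t, s)) e @[e --> 0^'+] --> \int[m]_s K s.
Proof.
move=> bnd cvgK.
have key (u : R^nat) : (forall n, 0 < u n) -> u n @[n --> \oo] --> 0 ->
    m.-integrable setT (EFin \o K) /\
    cutint T (fun t => q t * \int[m]_s phi (t, s)) (u n) @[n --> \oo] --> \int[m]_s K s.
  move=> u0 cu.
  apply: (kernel_average_cvg mphi phiw iw (D := fun n => `[u n, T]%classic) (C := C)).
  - by move=> n; exact: completed_measurable_itv.
  - by move=> n; exact: iq.
  - by move=> n s; exact: bnd.
  - by move=> s; move/cvg_at_rightP : (cvgK s); apply.
split; last by apply/cvg_at_rightP => u [u0 cu]; exact: (key u u0 cu).2.
apply: (key (fun n => n.+1%:R^-1) _ _).1.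
  by move=> n; rewrite invr_gt0.
exact: cvg_harmonic.
Qed.

End one_average.

(** [f] is the sine or the cosine, and [K] the limit of the truncated transform
    of [q]. *)
Variables (f : R -> R) (K : R -> R) (C : R).
Hypothesis mf : measurable_fun setT f.
Hypothesis f1 : forall t, `|f t| <= 1.
Hypothesis cutC : forall e u, 0 < e -> `|cutint T (fun t => q t * f (t * u)) e| <= C.
Hypothesis cutK : forall u, cutint T (fun t => q t * f (t * u)) e @[e --> 0^'+] --> K u.
Variables (k : nat) (x : R).
Hypothesis hk : (1 <= k)%N.
Notation leb := (@lebesgue_measure R).
Notation w := (@unit_weight R k).

(** The expectation of [g (x - A y)] for [A] of density [unit_weight]. *)
Definition smear (g : R -> R) (y : R) : R := \int[leb]_a (g (x - a * y) * w a).

Let measurable_arg : measurable_fun setT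
  (fun z : R * R * R => z.1.1 * (x - z.2 * z.1.2)).
Proof.
apply: measurable_funM; first exact: measurableT_comp measurable_fst measurable_fst.
apply: measurable_funB => //; apply: measurable_funM => //.
exact: measurableT_comp measurable_snd measurable_fst.
Qed.

Let mphi2 : measurable_fun setT
  (fun z : R * R * R => f (z.1.1 * (x - z.2 * z.1.2)) * w z.2).
Proof.
apply: measurable_funM; first exact: measurableT_comp measurable_arg.
exact: measurableT_comp (measurable_unit_weight k) measurable_snd.
Qed.

Let mphi1 y : measurable_fun setT
  (fun z : cR * measurableTypeR R => f (z.1 * (x - z.2 * y)) * w z.2).
Proof.
have mid : measurable_fun setT (fun z : cR * R => (z.1 : R)).
  exact: measurableT_comp (measurable_completed_id R) measurable_fst.
have := measurable_fun_pair (measurable_fun_pair mid (measurable_cst y))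
  (@measurable_snd _ _ cR R).
exact: measurableT_comp mphi2.
Qed.

Let w0 a : `|w a| = w a. Proof. by rewrite ger0_norm// unit_weight_ge0. Qed.

Let iw := @integrable_unit_weight R k hk.

Let intw : \int[leb]_a w a = 1.
Proof. by rewrite /Rintegral (integral_unit_weight hk). Qed.

Lemma smear_integrable t y :
  leb.-integrable setT (fun a => (f (t * (x - a * y)) * w a)%:E).
Proof.
have phiw (t' : cR) a : `|f (t' * (x - a * y)) * w a| <= w a.
  by rewrite normrM w0 ler_piMl// unit_weight_ge0.
exact: (integrable_dominated_section (mphi1 y) phiw iw t).
Qed.

Lemma norm_smear_le1 t y : `|smear (fun u => f (t * u)) y| <= 1.
Proof.
apply: (le_trans (le_normr_Rintegral measurableT (smear_integrable t y))).
rewrite -intw; apply: le_Rintegral => //.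
- exact: integrable_norm (smear_integrable t y).
- by move=> a _; rewrite normrM w0 ler_piMl// unit_weight_ge0.
Qed.

(** Joint measurability of an integral depending on parameters comes with
    Tonelli for nonnegative integrands, whence the shift by [1]. *)
Lemma measurable_smear_kernel :
  measurable_fun setT (fun z : R * R => smear (fun u => f (z.1 * u)) z.2).
Proof.
pose h (z : R * R * measurableTypeR R) := ((1 + f (z.1.1 * (x - z.2 * z.1.2))) * w z.2)%:E.
have mh : measurable_fun setT (h : R * R * R -> \bar R).
  apply/measurable_EFinP; apply: measurable_funM.
    apply: measurable_funD => //; exact: measurableT_comp measurable_arg.
  exact: measurableT_comp (measurable_unit_weight k) measurable_snd.
have h0 z : (0 <= h z)%E.
  rewrite lee_fin mulr_ge0// ?unit_weight_ge0//.
  by have := f1 (z.1.1 * (x - z.2 * z.1.2)); rewrite ler_norml => /andP[]; lra.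
have := @measurable_fun_fubini_tonelli_F _ _ (R * R)%type (measurableTypeR R) R leb h mh h0.
have E z : fubini_F leb h z = (1 + smear (fun u => f (z.1 * u)) z.2)%:E.
  rewrite /fubini_F /h /=.
  under eq_integral do rewrite mulrDl mul1r EFinD.
  rewrite (integralD measurableT iw (smear_integrable z.1 z.2)).
  rewrite [X in (X + _)%E](integral_unit_weight hk) EFinD; congr (_ + _)%E.
  rewrite /smear /Rintegral fineK//.
  exact: integrable_fin_num (smear_integrable z.1 z.2).
rewrite (funext E) => /measurable_EFinP m1.
have := measurable_funB m1 (measurable_cst (1 : R)).
by apply: eq_measurable_fun => z _ /=; rewrite addrAC subrr add0r.
Qed.

Lemma smear_cut y :
  [/\ leb.-integrable setT (fun a => (K (x - a * y) * w a)%:E),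
      forall e, 0 < e ->
        `|cutint T (fun t => q t * smear (fun u => f (t * u)) y) e| <= C &
      cutint T (fun t => q t * smear (fun u => f (t * u)) y) e @[e --> 0^'+]
        --> smear K y].
Proof.
pose phi (z : cR * measurableTypeR R) : R := f (z.1 * (x - z.2 * y)) * w z.2.
have phiw t a : `|phi (t, a)| <= w a.
  by rewrite normrM w0 ler_piMl// unit_weight_ge0.
have cutE e a : 0 < e -> cutint T (fun t => q t * phi (t, a)) e =
    cutint T (fun t => q t * f (t * (x - a * y))) e * w a.
  move=> e0; rewrite /cutint -RintegralZr.
  - by apply: eq_Rintegral => t _; rewrite /phi/=; ring.
  - exact: completed_measurable_itv.
  - apply: (integrable_mul_bounded (completed_measurable_itv _) (iq e0) _ (fun t => f1 _)).
    exact: measurableT_comp mf (mulrr_measurable _).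
have bnd e a : 0 < e -> `|cutint T (fun t => q t * phi (t, a)) e| <= C * w a.
  by move=> e0; rewrite cutE// normrM w0 ler_wpM2r ?unit_weight_ge0// cutC.
have cv a : cutint T (fun t => q t * phi (t, a)) e @[e --> 0^'+] --> K (x - a * y) * w a.
  apply: (@cvg_trans _ (cutint T (fun t => q t * f (t * (x - a * y))) e * w a
    @[e --> 0^'+])); last by apply: cvgMl; exact: cutK.
  apply: near_eq_cvg; near=> e.
  have e0 : 0 < e by near: e; exact: nbhs_right_gt.
  by rewrite cutE.
have [iK cvK] := cut_average_cvg (mphi1 y) phiw iw bnd cv.
split => //.
move=> e e0; have := kernel_average_le (mphi1 y) phiw iw
  (completed_measurable_itv `[e, T]) (iq e0) (fun a => bnd e a e0).
by rewrite intw mulr1.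
Unshelve. all: by end_near. Qed.

Section mixture.
Context d (Omega : measurableType d) (P : probability Omega R).
Variables (X : Omega -> R) (p : R -> R) (s : R).
Hypothesis mX : measurable_fun setT X.
Hypothesis mp : measurable_fun setT p.
Hypothesis ip : P.-integrable setT (fun o => (p (X o))%:E).
Hypothesis s1 : `|s| = 1.

(** The two cases of interest are [p y = y ^+ k] with [s = -1], for
    [X^k (W - V)], and [p y = `|y| ^+ k] with [s = 1], for [|X|^k (W + V)]. *)
Definition mixture_kernel (t y : R) : R :=
  p y * (smear (fun u => f (t * u)) y + s * f (t * (x - y))).

Definition mixture_limit (y : R) : R := p y * (smear K y + s * K (x - y)).

Let phi (z : cR * Omega) : R := mixture_kernel z.1 (X z.2).

Let mphi : measurable_fun setT phi.
Proof.
have mid : measurable_fun setT (fun z : cR * Omega => (z.1 : R)).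
  exact: measurableT_comp (measurable_completed_id R) measurable_fst.
have mX2 : measurable_fun setT (fun z : cR * Omega => X z.2).
  exact: measurableT_comp mX measurable_snd.
apply: measurable_funM; first exact: measurableT_comp mp mX2.
apply: measurable_funD.
  exact: measurableT_comp measurable_smear_kernel (measurable_fun_pair mid mX2).
apply: measurable_funM => //; apply: measurableT_comp => //.
by apply: measurable_funM => //; exact: measurable_funB.
Qed.

Let phiw t o : `|phi (t, o)| <= 2 * `|p (X o)|.
Proof.
rewrite /phi /mixture_kernel normrM mulrC ler_wpM2r// (le_trans (ler_normD _ _))//.
by rewrite -[2]/(1 + 1) lerD ?norm_smear_le1// normrM s1 mul1r.
Qed.

Let iw2 : P.-integrable setT (EFin \o (fun o => 2 * `|p (X o)|)).
Proof.
have := integrableZl measurableT 2 (integrable_norm ip).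
by apply: eq_integrable => // o _; rewrite /= EFinM.
Qed.

Lemma integrable_mixture_kernel t :
  P.-integrable setT (fun o => (mixture_kernel t (X o))%:E).
Proof. exact: (integrable_dominated_section mphi phiw iw2). Qed.

Lemma integrable_cut_mixture e : 0 < e ->
  lam.-integrable `[e, T] (fun t => (q t * \int[P]_o mixture_kernel t (X o))%:E).
Proof. exact: (integrable_cut_average mphi phiw iw2). Qed.

Lemma cut_mixture_cvg :
  P.-integrable setT (fun o => (mixture_limit (X o))%:E) /\
  cutint T (fun t => q t * \int[P]_o mixture_kernel t (X o)) e @[e --> 0^'+]
    --> \int[P]_o mixture_limit (X o).
Proof.
have cutE e o : 0 < e -> cutint T (fun t => q t * phi (t, o)) e =
    p (X o) * (cutint T (fun t => q t * smear (fun u => f (t * u)) (X o)) e +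
      s * cutint T (fun t => q t * f (t * (x - X o))) e).
  move=> e0; have mD := completed_measurable_itv `[e, T].
  have i1 : lam.-integrable `[e, T]
      (EFin \o (fun t => q t * smear (fun u => f (t * u)) (X o))).
    apply: (integrable_mul_bounded mD (iq e0) _ (fun t => norm_smear_le1 t _)).
    exact: measurableT_comp measurable_smear_kernel (measurable_pair2 _).
  have i2 : lam.-integrable `[e, T] (EFin \o (fun t => q t * f (t * (x - X o)))).
    apply: (integrable_mul_bounded mD (iq e0) _ (fun t => f1 _)).
    exact: measurableT_comp mf (mulrr_measurable _).
  have i3 : lam.-integrable `[e, T] (EFin \o (fun t => s * (q t * f (t * (x - X o))))).
    have := integrableZl mD s i2.
    by apply: eq_integrable => // t _; rewrite /= EFinM.
  have i4 : lam.-integrable `[e, T] (EFin \o (fun t =>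
      q t * smear (fun u => f (t * u)) (X o) + s * (q t * f (t * (x - X o))))).
    have := integrableD mD i1 i3.
    by apply: eq_integrable => // t _; rewrite /= EFinD.
  rewrite /cutint -(RintegralZl s mD i2) -(RintegralD mD i1 i3) -(RintegralZl _ mD i4).
  by apply: eq_Rintegral => t _; rewrite /phi /mixture_kernel/=; ring.
apply: (cut_average_cvg (C := C) mphi phiw iw2).
- move=> e o e0; rewrite cutE// normrM mulrA mulrC ler_wpM2r//.
  rewrite mulrDr mulr1 (le_trans (ler_normD _ _))// lerD//.
    by have [_ + _] := smear_cut (X o); apply.
  by rewrite normrM s1 mul1r cutC.
- move=> o.
  have [_ _ cs] := smear_cut (X o).
  apply: (@cvg_trans _ (p (X o) *
     (cutint T (fun t => q t * smear (fun u => f (t * u)) (X o)) e +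
      s * cutint T (fun t => q t * f (t * (x - X o))) e) @[e --> 0^'+])).
    apply: near_eq_cvg; near=> e.
    have e0 : 0 < e by near: e; exact: nbhs_right_gt.
    by rewrite cutE.
  by apply: cvgMr; apply: cvgD => //; apply: cvgMr; exact: cutK.
Unshelve. all: by end_near. Qed.

End mixture.
End cut_average.

(** * The inequality for a constant random variable *)

Section pointwise.
Context {R : realType}.
Notation leb := (@lebesgue_measure R).
Variables (k : nat) (x : R).
Hypothesis hk : (1 <= k)%N.
Hypothesis hx : 0 <= x.
Notation w := (@unit_weight R k).

Lemma heaviside_smear_integrable y :
  leb.-integrable setT (fun a => (heaviside (x - a * y) * w a)%:E).
Proof.
have s1 (t : R) : `|heaviside t| <= 1.
  by rewrite /heaviside; case: (0 <= t); rewrite ?normr1 ?normr0.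
have := smear_integrable (@measurable_heaviside R) s1 x hk 1 y.
by apply: eq_integrable => // a _; rewrite mul1r.
Qed.

Let Rint_w : \int[leb]_a w a = 1.
Proof. by rewrite /Rintegral (integral_unit_weight hk). Qed.

Lemma smear_heaviside_lt y : y < x -> smear k x heaviside y = 1.
Proof.
move=> yx; rewrite -Rint_w; apply: eq_Rintegral => a _.
rewrite /unit_weight patchE; case: ifPn => [|_]; last by rewrite mulr0.
move=> /set_mem/=; rewrite in_itv/= => /andP[a0 a1].
have ayx : a * y <= x.
  have [y0|y0] := leP 0 y.
    by apply: (le_trans (ler_piMl y0 a1)); exact: ltW.
  by apply: (le_trans _ hx); rewrite mulr_ge0_le0// ltW.
by rewrite /heaviside subr_ge0 ayx mul1r.
Qed.

Lemma smear_heaviside_ge y : 0 < y -> x <= y -> smear k x heaviside y = (x / y) ^+ k.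
Proof.
move=> y0 xy; have r0 : 0 <= x / y by rewrite divr_ge0// ltW.
have E := integral_power_density hk r0.
rewrite /smear /Rintegral -[RHS]/(fine ((x / y) ^+ k)%:E) -E; congr fine.
rewrite [RHS]integral_mkcond; apply: eq_integral => a _.
rewrite /unit_weight !patchE /heaviside subr_ge0 -ler_pdivlMr//.
rewrite !mem_setE !in_itv/=; case: (leP a (x / y)) => ay; rewrite ?andbT ?andbF/=.
  rewrite mul1r (le_trans ay) ?ler_pdivrMr ?mul1r// andbT.
  by case: ifP.
by rewrite mul0r.
Qed.

(** For [y < x] both the average and [b] are [1].  For [x <= y] and [0 < y] the
    average is [(x / y)^k]; there [b] can be [1] only when [x = y], and then the
    average is [1] too.  For [x <= y <= 0] both [x] and [y] are [0], and both
    sides vanish. *)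
Lemma power_indicator (y : R) (b : bool) : b = (y < x) \/ b = (y <= x) ->
  y ^+ k * (smear k x heaviside y - b%:R) = x ^+ k * (~~ b)%:R.
Proof.
move=> hbc.
have [yx|xy] := ltP y x.
  have -> : b = true by case: hbc => ->; rewrite ?yx ?(ltW yx).
  by rewrite smear_heaviside_lt// subrr !mulr0.
have [y0|y0] := ltP 0 y.
  rewrite smear_heaviside_ge// mulrBr -exprMn mulrC divfK ?gt_eqF//.
  case: b hbc => /=; last by rewrite mulr0 subr0 mulr1.
  case; first by rewrite ltNge xy.
  move=> /esym yx; have -> : x = y by apply/eqP; rewrite eq_le xy yx.
  by rewrite mulr1 mulr0 subrr.
have -> : y = 0 by apply/eqP; rewrite eq_le y0 (le_trans hx).
have -> : x = 0 by apply/eqP; rewrite eq_le hx (le_trans xy).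
by rewrite expr0n (gtn_eqF hk) !mul0r.
Qed.

Variables A B : R -> R.
Hypothesis AB : forall u, 2^-1 + (A u + B u) / pi <= (0 < u)%R%:R /\
  (0 <= u)%R%:R <= 2^-1 + (A u - B u) / pi.
Hypothesis iA : forall y, leb.-integrable setT (fun a => (A (x - a * y) * w a)%:E).
Hypothesis iB : forall y, leb.-integrable setT (fun a => (B (x - a * y) * w a)%:E).

Let heaviside_dist (u : R) (b : bool) : b = (0 < u) \/ b = (0 <= u) ->
  `|b%:R - 2^-1 - A u / pi| <= - (B u / pi).
Proof.
move=> hb; have [le1 le2] := AB u.
have m1 : ((0 < u)%R%:R : R) <= b%:R.
  by case: hb => ->//; rewrite ler_nat; case: (ltP 0 u) => // /ltW ->.
have m2 : (b%:R : R) <= (0 <= u)%R%:R.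
  by case: hb => ->//; rewrite ler_nat; case: (ltP 0 u) => // /ltW ->.
move: le1 le2; rewrite mulrDl mulrBl => le1 le2.
by rewrite ler_norml; apply/andP; split; lra.
Qed.

Lemma smear_heaviside_dist y :
  `|smear k x heaviside y - 2^-1 - smear k x A y / pi| <= - (smear k x B y / pi).
Proof.
have mT := @measurableT _ (measurableTypeR R).
have iw := @integrable_unit_weight R k hk.
have Z g c (ig : leb.-integrable setT (fun a => (g a)%:E)) :
    leb.-integrable setT (fun a => (c * g a)%:E).
  have := integrableZl mT c ig.
  by apply: eq_integrable => // a _; rewrite EFinM.
have is_ := heaviside_smear_integrable y.
pose F a := (heaviside (x - a * y) - 2^-1 - A (x - a * y) / pi) * w a.
pose F1 a := heaviside (x - a * y) * w a - 2^-1 * w a.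
have iF1 : leb.-integrable setT (EFin \o F1).
  exact: (integrableB mT is_ (Z _ 2^-1 iw)).
have iA' := Z _ (pi^-1 : R) (iA y).
have iB' := Z _ (- pi^-1 : R) (iB y).
have iF2 : leb.-integrable setT (EFin \o (fun a => F1 a - pi^-1 * (A (x - a * y) * w a))).
  exact: (integrableB mT iF1 iA').
have -> : smear k x heaviside y - 2^-1 - smear k x A y / pi = \int[leb]_a F a.
  transitivity (\int[leb]_a (F1 a - pi^-1 * (A (x - a * y) * w a))).
    rewrite (RintegralB mT iF1 iA') (RintegralB mT is_ (Z _ 2^-1 iw)).
    by rewrite (RintegralZl _ mT iw) Rint_w (RintegralZl _ mT (iA y)) mulr1 (mulrC pi^-1).
  by apply: eq_Rintegral => a _; rewrite /F /F1; ring.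
have iF : leb.-integrable setT (EFin \o F).
  by move: iF2; apply: eq_integrable => // a _; rewrite /F /F1/=; congr EFin; ring.
have -> : - (smear k x B y / pi) = \int[leb]_a (- pi^-1 * (B (x - a * y) * w a)).
  by rewrite (RintegralZl _ mT (iB y)) mulNr (mulrC pi^-1).
apply: (le_trans (le_normr_Rintegral mT iF)); apply: le_Rintegral => //.
  exact: integrable_norm iF.
move=> a _; rewrite /F normrM (ger0_norm (unit_weight_ge0 _ _)).
rewrite mulrA ler_wpM2r ?unit_weight_ge0// mulNr (mulrC pi^-1).
by apply: heaviside_dist; right.
Qed.

(** The theorem for the deterministic random variable [y], up to the factor
    [1 / pi]: the two indicators enter through [power_indicator], and the
    constants [1/2] of the two terms cancel. *)
Lemma pointwise_smoothing (y : R) (b : bool) : b = (y < x) \/ b = (y <= x) ->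
  `|x ^+ k * (~~ b)%:R - mixture_limit A k x (fun z => z ^+ k) (-1) y / pi| <=
  - (mixture_limit B k x (fun z => `|z| ^+ k) 1 y / pi).
Proof.
move=> hbc; rewrite -(power_indicator hbc) /mixture_limit.
have d1 := smear_heaviside_dist y.
have d2 : `|b%:R - 2^-1 - A (x - y) / pi| <= - (B (x - y) / pi).
  by apply: heaviside_dist; rewrite subr_gt0 subr_ge0.
rewrite [X in `|X|](_ : _ = y ^+ k * ((smear k x heaviside y - 2^-1 - smear k x A y / pi) -
   (b%:R - 2^-1 - A (x - y) / pi))); last by ring.
rewrite [leRHS](_ : _ = `|y| ^+ k * (- (smear k x B y / pi) - B (x - y) / pi));
  last by ring.
rewrite normrM normrX; apply: ler_wpM2l; first exact: exprn_ge0.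
apply: (le_trans (ler_normB _ _)).
exact: lerD.
Qed.

End pointwise.

(** * The transform of a mixture *)

Section mixture_transform.
Context {R : realType}.
Notation leb := (@lebesgue_measure R).
Notation lam := (@completed_lebesgue_measure R).
Variable k : nat.
Hypothesis hk : (1 <= k)%N.
Notation w := (@unit_weight R k).

Let smearD x (f g h : R -> R) (a b : R) y :
  leb.-integrable setT (fun z => (f (0 - z * y) * w z)%:E) ->
  leb.-integrable setT (fun z => (g (0 - z * y) * w z)%:E) ->
  (forall z, h (x - z * y) = a * f (0 - z * y) + b * g (0 - z * y)) ->
  smear k x h y = a * smear k 0 f y + b * smear k 0 g y.
Proof.
move=> i1 i2 E; have mT := @measurableT _ (measurableTypeR R).
have Z c f' (ig : leb.-integrable setT (fun a => (f' a)%:E)) :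
    leb.-integrable setT (fun a => (c * f' a)%:E).
  have := integrableZl mT c ig.
  by apply: eq_integrable => // z _; rewrite EFinM.
rewrite /smear -(RintegralZl a mT i1) -(RintegralZl b mT i2).
rewrite -(RintegralD mT (Z a _ i1) (Z b _ i2)).
by apply: eq_Rintegral => z _; rewrite E; ring.
Qed.

Let icos := smear_integrable (@measurable_cos R) (@cos_max R) 0 hk.
Let isin := smear_integrable (@measurable_sin R) (@sin_max R) 0 hk.

(** The addition formulas express the factor [e^{-itx}] of the transform as a
    translation of the argument by [x]; [W] and [V] are the case [x = 0]. *)
Lemma mixture_kernel_cosD p (s x t y : R) : mixture_kernel cos k x p s t y =
  cos (t * x) * mixture_kernel cos k 0 p s t y -
  sin (t * x) * mixture_kernel sin k 0 p s t y.
Proof.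
have E z : t * (x - z) = t * x + t * (0 - z) by ring.
rewrite /mixture_kernel (@smearD x (fun u => cos (t * u)) (fun u => sin (t * u))
  (fun u => cos (t * u)) (cos (t * x)) (- sin (t * x)) y (icos t y) (isin t y)).
  by rewrite E cosD; ring.
by move=> z; rewrite E cosD; ring.
Qed.

Lemma mixture_kernel_sinD p (s x t y : R) : mixture_kernel sin k x p s t y =
  sin (t * x) * mixture_kernel cos k 0 p s t y +
  cos (t * x) * mixture_kernel sin k 0 p s t y.
Proof.
have E z : t * (x - z) = t * x + t * (0 - z) by ring.
rewrite /mixture_kernel (@smearD x (fun u => cos (t * u)) (fun u => sin (t * u))
  (fun u => sin (t * u)) (sin (t * x)) (cos (t * x)) y (icos t y) (isin t y)).
  by rewrite E sinD; ring.
by move=> z; rewrite E sinD; ring.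
Qed.

Lemma mixture_kernel_cosN p (s x t y : R) :
  mixture_kernel cos k x p s (- t) y = mixture_kernel cos k x p s t y.
Proof.
rewrite /mixture_kernel mulNr cosN; congr (_ * (_ + _)).
by apply: eq_Rintegral => a _; rewrite mulNr cosN.
Qed.

Lemma mixture_kernel_sinN p (s x t y : R) :
  mixture_kernel sin k x p s (- t) y = - mixture_kernel sin k x p s t y.
Proof.
rewrite /mixture_kernel mulNr sinN.
have mT := @measurableT _ (measurableTypeR R).
rewrite (_ : smear k x _ y = - smear k x (fun u => sin (t * u)) y); first by ring.
rewrite /smear -[RHS]mulN1r -(RintegralZl (-1) mT); last first.
  exact: (smear_integrable (@measurable_sin R) (@sin_max R) x hk).
by apply: eq_Rintegral => a _; rewrite mulNr sinN; ring.
Qed.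

Lemma W_smear (t y : R) : W k y t =
  smear k 0 (fun u => cos (t * u)) y +i* - smear k 0 (fun u => sin (t * u)) y.
Proof.
rewrite /W /cintegral; congr Complex; rewrite /smear.
  rewrite Rintegral_mkcond; apply: eq_Rintegral => a _.
  rewrite /unit_weight !patchE; case: ifPn => _; last by rewrite mulr0.
  rewrite /= mulr0 subr0 /power_density; congr (_ * _).
  by rewrite sub0r mulrN cosN; congr cos; ring.
have mT := @measurableT _ (measurableTypeR R).
rewrite Rintegral_mkcond -mulN1r -(RintegralZl (-1) mT (isin t y)).
apply: eq_Rintegral => a _.
rewrite /unit_weight !patchE; case: ifPn => _; last by rewrite !mulr0.
rewrite /= mulr0 add0r /power_density sub0r mulrN sinN mulrA mulN1r opprK.
by congr (sin _ * _); ring.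
Qed.

Context d (Omega : measurableType d) (P : probability Omega R).
Variables (X : Omega -> R) (p : R -> R) (s : R).
Hypothesis mX : measurable_fun setT X.
Hypothesis mp : measurable_fun setT p.
Hypothesis ip : P.-integrable setT (fun o => (p (X o))%:E).
Hypothesis s1 : `|s| = 1.

Definition mixture_transform (t : R) : R[i] :=
  cexpectation P (fun o => (p (X o))%:C * (W k (X o) t + s%:C * V (X o) t)).

Let ic x t := integrable_mixture_kernel (@measurable_cos R) (@cos_max R) x hk mX mp ip s1 t.
Let is_ x t := integrable_mixture_kernel (@measurable_sin R) (@sin_max R) x hk mX mp ip s1 t.

Definition cos_mixture x t := \int[P]_o mixture_kernel cos k x p s t (X o).
Definition sin_mixture x t := \int[P]_o mixture_kernel sin k x p s t (X o).

Lemma mixture_transformE t :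
  mixture_transform t = cos_mixture 0 t +i* - sin_mixture 0 t.
Proof.
rewrite /mixture_transform /cexpectation !unlock; congr Complex.
  apply: eq_Rintegral => o _; rewrite W_smear /V /expi /mixture_kernel /=.
  by rewrite sub0r mulrN cosN; ring.
rewrite /sin_mixture -mulN1r -(RintegralZl (-1) measurableT (is_ 0 t)).
apply: eq_Rintegral => o _; rewrite W_smear /V /expi /mixture_kernel /=.
by rewrite sub0r mulrN sinN; ring.
Qed.

Let ZP (c : R) (f : Omega -> R) : P.-integrable setT (EFin \o f) ->
  P.-integrable setT (fun o => (c * f o)%:E).
Proof.
move=> iF; have := integrableZl measurableT c iF.
by apply: eq_integrable => // o _; rewrite EFinM.
Qed.

Lemma cos_mixtureD x t : cos_mixture x t =
  cos (t * x) * cos_mixture 0 t - sin (t * x) * sin_mixture 0 t.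
Proof.
rewrite /cos_mixture /sin_mixture.
rewrite -(RintegralZl (cos (t * x)) measurableT (ic 0 t)).
rewrite -(RintegralZl (sin (t * x)) measurableT (is_ 0 t)).
rewrite -(RintegralB measurableT (ZP _ (ic 0 t)) (ZP _ (is_ 0 t))).
by apply: eq_Rintegral => o _; rewrite mixture_kernel_cosD.
Qed.

Lemma sin_mixtureD x t : sin_mixture x t =
  sin (t * x) * cos_mixture 0 t + cos (t * x) * sin_mixture 0 t.
Proof.
rewrite /cos_mixture /sin_mixture.
rewrite -(RintegralZl (sin (t * x)) measurableT (ic 0 t)).
rewrite -(RintegralZl (cos (t * x)) measurableT (is_ 0 t)).
rewrite -(RintegralD measurableT (ZP _ (ic 0 t)) (ZP _ (is_ 0 t))).
by apply: eq_Rintegral => o _; rewrite mixture_kernel_sinD.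
Qed.

Variable n : R -> R.
Let h x := Gkernel (fun t => (n t)%:C * mixture_transform t) x.

Lemma Re_Gkernel_mixture x t : complex.Re (h x t) = n t / t * cos_mixture x t.
Proof.
rewrite /h Re_Gkernel mixture_transformE (cos_mixtureD x) /=; ring.
Qed.

Lemma Im_Gkernel_mixture x t : complex.Im (h x t) = - (n t / t * sin_mixture x t).
Proof.
rewrite /h Im_Gkernel mixture_transformE (sin_mixtureD x) /=; ring.
Qed.

Lemma cos_mixtureN x t : cos_mixture x (- t) = cos_mixture x t.
Proof. by apply: eq_Rintegral => o _; rewrite mixture_kernel_cosN. Qed.

Lemma sin_mixtureN x t : sin_mixture x (- t) = - sin_mixture x t.
Proof.
rewrite /sin_mixture -[RHS]mulN1r -(RintegralZl (-1) measurableT (is_ x t)).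
by apply: eq_Rintegral => o _; rewrite mixture_kernel_sinN mulN1r.
Qed.

Variable T : R.
Hypothesis iq : forall e, 0 < e -> lam.-integrable `[e, T] (fun t => (n t / t)%:E).
Hypothesis q0 : forall t, T < t -> n t / t = 0.

(** [c] is the parity of [n t / t].  For [c = -1] only the sine transform
    survives in the principal value, and for [c = 1] only the cosine transform. *)
Lemma G_mixture (x c lc ls : R) :
  (forall t, n (- t) / - t = c * (n t / t)) ->
  (1 + c) * cutint T (fun t => n t / t * cos_mixture x t) e @[e --> 0^'+] --> lc ->
  (1 - c) * cutint T (fun t => n t / t * sin_mixture x t) e @[e --> 0^'+] --> ls ->
  Gexists (fun t => (n t)%:C * mixture_transform t) x /\
  G (fun t => (n t)%:C * mixture_transform t) x = (ls / (2 * pi)) +i* (lc / (2 * pi)).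
Proof.
move=> qc clc cls.
have RehE := Re_Gkernel_mixture x; have ImhE := Im_Gkernel_mixture x.
have icut e : 0 < e -> cintegrable lam `[e, T] (h x).
  move=> e0; have mD := completed_measurable_itv `[e, T]; split.
    have := integrable_cut_mixture iq (@measurable_cos R) (@cos_max R) x hk mX mp ip s1 e0.
    by apply: eq_integrable => // t _; rewrite RehE.
  have := integrable_cut_mixture iq (@measurable_sin R) (@sin_max R) x hk mX mp ip s1 e0.
  move=> /integrableN; apply: eq_integrable => // t _.
  by rewrite ImhE EFinN.
have [||||||ex pvE] := @pv_symmetric_kernel R T (h x) c (- c) lc (- ls).
- exact: icut.
- move=> t Tt; apply/eqP; rewrite eq_complex RehE ImhE q0//.
  by rewrite !mul0r oppr0 !eqxx.
- by move=> t; rewrite !RehE qc cos_mixtureN; ring.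
- by move=> t; rewrite !ImhE qc sin_mixtureN; ring.
- by rewrite (funext RehE).
- rewrite (funext ImhE).
  apply: (@cvg_trans _ (- ((1 - c) * cutint T (fun t => n t / t * sin_mixture x t) e)
    @[e --> 0^'+])); last exact: cvgN.
  apply: near_eq_cvg; near=> e.
  have e0 : 0 < e by near: e; exact: nbhs_right_gt.
  rewrite -mulrN; congr (_ * _).
  have := integrable_cut_mixture iq (@measurable_sin R) (@sin_max R) x hk mX mp ip s1 e0.
  move=> im; rewrite /cutint -[LHS]mulN1r.
  rewrite -(RintegralZl (-1) (completed_measurable_itv `[e, T]) im).
  by apply: eq_Rintegral => t _; rewrite mulN1r.
split; first exact: ex.
by rewrite (G_of_pv pvE) mulNr opprK.
Unshelve. all: by end_near. Qed.

End mixture_transform.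

(** * The tail inequality *)

Lemma le_expectation_indic d (Omega : measurableType d) (R : realType)
    (P : probability Omega R) (E : set Omega) (A B : Omega -> R) (c r : R) :
  measurable E -> P.-integrable setT (EFin \o A) -> P.-integrable setT (EFin \o B) ->
  (forall o, `|c * \1_E o - A o / r| <= - (B o / r)) ->
  `|c * fine (P E) - (\int[P]_o A o) / r| <= - ((\int[P]_o B o) / r).
Proof.
move=> mE iA iB le_AB.
have iE : P.-integrable setT (EFin \o \1_E) by exact: integrable_indic.
have iZ (u : R) (f : Omega -> R) : P.-integrable setT (EFin \o f) ->
    P.-integrable setT (EFin \o (fun o => u * f o)).
  move=> iF; have := integrableZl measurableT u iF.
  by apply: eq_integrable => // o _; rewrite /= EFinM.
have -> : fine (P E) = \int[P]_o \1_E o.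
  by rewrite /Rintegral integral_indic// setIT.
have -> : - ((\int[P]_o B o) / r) = - r^-1 * \int[P]_o B o by rewrite mulNr mulrC.
rewrite (mulrC _ r^-1).
rewrite -(RintegralZl c measurableT iE) -(RintegralZl r^-1 measurableT iA).
rewrite -(RintegralZl (- r^-1) measurableT iB).
have iEc := iZ c _ iE; have iAr := iZ r^-1 _ iA.
rewrite -(RintegralB measurableT iEc iAr).
have iD := integrableB measurableT iEc iAr.
apply: (le_trans (le_normr_Rintegral measurableT iD)).
apply: le_Rintegral => //; first exact: integrable_norm iD.
- exact: iZ.
- by move=> o _; rewrite mulNr !(mulrC r^-1); exact: le_AB.
Qed.

Theorem theorem3p1 (R : realType) (k : nat) (hk : (1 <= k)%N) (M : R -> R[i])
  (ha : smoothing_inequalities M)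
  (hb : forall t : R, 1 < `|t| -> M t = 0)
  (hc : forall t : R, M1 M (- t) = M1 M t /\ M2 M (- t) = - M2 M t)
  (hd : exists kappa : R,
     cintegrable completed_lebesgue_measure `[-1, 1]
       (fun t : R => (M t - kappa%:C) / t%:C))
  (T : R) (hT : 0 < T) (x : R) (hx : 0 <= x)
  (d : measure_display) (Omega : measurableType d) (P : probability Omega R)
  (X : {RV P >-> R})
  (hX : ('E_P[fun w => (`|X w| ^+ k)%R] < +oo)%E) :
  let g1 (t : R) : R[i] :=
    (M1 M (t / T))%:C
    * cexpectation P (fun w => (X w ^+ k)%:C * (W k (X w) t - V (X w) t)) in
  let g2 (t : R) : R[i] :=
    (M2 M (t / T))%:C
    * cexpectation P (fun w => (`|X w| ^+ k)%:C * (W k (X w) t + V (X w) t)) in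
  [/\ Gexists g1 x,
      Gexists g2 x,
      `| (x ^+ k * fine (P [set w | x <= X w]))%:C - G g1 x | <= 'i%C * G g2 x
    & `| (x ^+ k * fine (P [set w | x < X w]))%:C - G g1 x | <= 'i%C * G g2 x].
Proof.
move=> g1 g2.
have mX : measurable_fun setT (X : Omega -> R) by exact: measurable_funPT.
pose p1 (y : R) := y ^+ k; pose p2 (y : R) := `|y| ^+ k.
have mp1 : measurable_fun setT p1 by exact: measurable_funX.
have mp2 : measurable_fun setT p2 by apply: measurable_funX; exact: normr_measurable.
have ip2 : P.-integrable setT (fun o => (p2 (X o))%:E).
  apply/integrableP; split.
    by apply/measurable_EFinP; exact: measurableT_comp mp2 mX.
  move: hX; rewrite unlock; apply: le_lt_trans; rewrite le_eqVlt; apply/orP; left.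
  apply/eqP; apply: eq_integral => o _.
  by rewrite /= ger0_norm// exprn_ge0.
have ip1 : P.-integrable setT (fun o => (p1 (X o))%:E).
  apply: le_integrable ip2 => //.
    by apply/measurable_EFinP; exact: measurableT_comp mp1 mX.
  by move=> o _; rewrite lee_fin /= /p1 /p2 !normrX normr_id.
have [C BC] := cut_bounded ha hb hc hd hT.
have ds := dirac_smoothing ha hb hc hT.
have iqs e (e0 : 0 < e) := (weights_integrable ha hb hc hT e0).1.
have iqc e (e0 : 0 < e) := (weights_integrable ha hb hc hT e0).2.
have sB e u (e0 : 0 < e) := (BC e u e0).1.
have cB e u (e0 : 0 < e) := (BC e u e0).2.
have sC u : sin_cut M T e u @[e --> 0^'+] --> sin_lim M T u by have [] := ds u.
have cC u : cos_cut M T e u @[e --> 0^'+] --> cos_lim M T u by have [] := ds u.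
have absN1 : `|-1| = 1 :> R by rewrite normrN1.
have abs1 : `|1| = 1 :> R by rewrite normr1.
have [iL1 cL1] := cut_mixture_cvg iqs (@measurable_sin R) (@sin_max R) sB sC x hk mX mp1 ip1 absN1.
have [iL2 cL2] := cut_mixture_cvg iqc (@measurable_cos R) (@cos_max R) cB cC x hk mX mp2 ip2 abs1.
set L1 := Rintegral _ _ _ in cL1; set L2 := Rintegral _ _ _ in cL2.
(* [M1 (t / T) / t] is odd, so that only the sine transform contributes *)
have [ex1 G1] : Gexists g1 x /\ G g1 x = (L1 / pi)%:C.
  have -> : g1 = (fun t => (M1 M (t / T))%:C * mixture_transform k P X p1 (-1) t).
    apply/funext => t; rewrite /g1 /mixture_transform; congr (_ * cexpectation P _).
    by apply/funext => o; rewrite rmorphN1 mulN1r.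
  have [|||ex GE] := @G_mixture R k hk d Omega P X p1 (-1) mX mp1 ip1 absN1
    (fun t => M1 M (t / T)) T iqs (sin_weight_eq0 hb hT) x (-1) 0 (2 * L1).
  - by move=> t; rewrite mulN1r; exact: (sin_weightN hc).
  - by rewrite subrr; exact: cvg_mul0.
  - rewrite opprK; apply: cvgMr; exact: cL1.
  split => //; rewrite GE mul0r.
  by congr (_ +i* _); rewrite invfM mulrACA divff ?mul1r// pnatr_eq0.
(* [M2 (t / T) / t] is even, so that only the cosine transform contributes *)
have [ex2 G2] : Gexists g2 x /\ 'i%C * G g2 x = (- (L2 / pi))%:C.
  have -> : g2 = (fun t => (M2 M (t / T))%:C * mixture_transform k P X p2 1 t).
    apply/funext => t; rewrite /g2 /mixture_transform; congr (_ * cexpectation P _).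
    by apply/funext => o; rewrite mul1r.
  have [|||ex GE] := @G_mixture R k hk d Omega P X p2 1 mX mp2 ip2 abs1
    (fun t => M2 M (t / T)) T iqc (cos_weight_eq0 hb hT) x 1 (2 * L2) 0.
  - by move=> t; rewrite mul1r; exact: (cos_weightN hc).
  - apply: cvgMr; exact: cL2.
  - by rewrite subrr; exact: cvg_mul0.
  split => //; rewrite GE mul0r.
  have -> : 2 * L2 / (2 * pi) = L2 / pi.
    by rewrite invfM mulrACA divff ?mul1r// pnatr_eq0.
  by congr (_ +i* _); rewrite /=; ring.
(* the expectation of [pointwise_smoothing] *)
have main (b : R -> bool) : measurable [set o | ~~ b (X o)] ->
    (forall y, b y = (y < x) \/ b y = (y <= x)) ->
    `|x ^+ k * fine (P [set o | ~~ b (X o)]) - L1 / pi| <= - (L2 / pi).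
  move=> mE hbx; set E := [set o | _] in mE *.
  have iA y := let: And3 iA _ _ :=
    smear_cut iqs (@measurable_sin R) (@sin_max R) sB sC x hk y in iA.
  have iB y := let: And3 iB _ _ :=
    smear_cut iqc (@measurable_cos R) (@cos_max R) cB cC x hk y in iB.
  have AB u : 2^-1 + (sin_lim M T u + cos_lim M T u) / pi <= (0 < u)%R%:R /\
      (0 <= u)%R%:R <= 2^-1 + (sin_lim M T u - cos_lim M T u) / pi.
    by have [_ _ ? ?] := ds u.
  have pw o := pointwise_smoothing hk hx AB iA iB (hbx (X o)).
  apply: (le_expectation_indic mE iL1 iL2) => o.
  rewrite indicE (_ : (o \in E) = ~~ b (X o)); first exact: pw.
  by rewrite /E mem_setE.
have complex_main (r : R) : `|r - L1 / pi| <= - (L2 / pi) ->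
    `|r%:C - G g1 x| <= 'i%C * G g2 x.
  by move=> le; rewrite G1 G2 -rmorphB normc_def /= expr0n addr0 sqrtr_sqr lecR.
split => //; apply: complex_main.
- have -> : [set o | x <= X o] = [set o | ~~ (X o < x)].
    by apply/seteqP; split => o /=; rewrite leNgt.
  apply: (main (fun y => y < x)) => [|y]; last by left.
  rewrite (_ : mkset _ = X @^-1` `[x, +oo[); first exact: measurable_funPTI.
  by apply/seteqP; split => o /=; rewrite in_itv/= andbT leNgt.
- have -> : [set o | x < X o] = [set o | ~~ (X o <= x)].
    by apply/seteqP; split => o /=; rewrite ltNge.
  apply: (main (fun y => y <= x)) => [|y]; last by right.
  rewrite (_ : mkset _ = X @^-1` `]x, +oo[); first exact: measurable_funPTI.
  by apply/seteqP; split => o /=; rewrite in_itv/= andbT ltNge.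
Qed.
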